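(* Let $s,t,r\in\mathbb{N}$ with $s\leqslant rt$ and $r\leqslant st$. Then the set $\mathcal{C}^{\mathrm{e}}_{s,t,r}$ is an open subset of $\mathcal{C}_{s,t,r}$. In particular, $\mathcal{C}^{\mathrm{e}}_{s,t,r}$ is a smooth embedded submanifold of $\mathcal{C}_{s,t,r}$ and of $\mathbb{R}^{2s^2t^2}$, of dimension $2srt-r^2-s^2$. Moreover, $\mathcal{C}^{\mathrm{e}}_{s,t,s}\neq\emptyset$.
   Context: Identify $\mathbb{C}^{st\times st}\cong\mathbb{R}^{2s^2t^2}$. Let $\mathcal{C}_{s,t}$ be the set of (Choi-states) $C_{AB}\in\mathbb{C}^{st\times st}$, $C_{AB}$ positive semi-definite on $\mathbb{C}^s\otimes\mathbb{C}^t$ (system $A$ of dimension $s$, system $B$ of dimension $t$), with $\mathrm{tr}_B\,C_{AB}=\frac{1}{s}I_s$. This is a convex set. Let $\mathcal{C}_{s,t,r}$ be the set of elements of $\mathcal{C}_{s,t}$ of rank $r$, and $\mathcal{C}^{\mathrm{e}}_{s,t,r}$ the set of elements of $\mathcal{C}_{s,t,r}$ that are extreme points of $\mathcal{C}_{s,t}$. The set $\mathcal{C}_{s,t,r}$ is a smooth embedded submanifold of $\mathbb{R}^{2s^2t^2}$ (with the subspace topology). *)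

(* Defs.v *)
From HB Require Import structures.
From mathcomp Require Import all_boot all_order all_algebra.
From mathcomp Require Import complex mxtens.
From mathcomp Require Import classical_sets reals topology normedtype derive.
Set Implicit Arguments. Unset Strict Implicit. Unset Printing Implicit Defensive.
Import Order.TTheory GRing.Theory Num.Theory.
Import numFieldNormedType.Exports.
Local Open Scope ring_scope.
Local Open Scope classical_set_scope.

Section ChoiDefs.
Variable R : realType.
Local Notation C := (R[i]).

Definition adjmx m n (M : 'M[C]_(m, n)) : 'M[C]_(n, m) := map_mx Num.conj M^T.

Definition psdmx n (M : 'M[C]_n) : Prop :=
  M = adjmx M /\ forall v : 'rV[C]_n, 0 <= (v *m M *m adjmx v) 0 0.

(* partial trace over system B, with the standard tensor index
   (a, b) |-> a * t + b of C^s (x) C^t (system A of dim s, B of dim t) *)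
Definition ptraceB s t (M : 'M[C]_(s * t)) : 'M[C]_s :=
  \matrix_(i, j) \sum_(k < t) M (mxtens_index (i, k)) (mxtens_index (j, k)).

Definition Choi s t : set 'M[C]_(s * t) :=
  [set M | psdmx M /\ ptraceB M = (s%:R)^-1%:M].
Arguments Choi : clear implicits.

Definition ChoiRank s t r : set 'M[C]_(s * t) :=
  [set M | Choi s t M /\ \rank M = r].
Arguments ChoiRank : clear implicits.

Definition extreme_point m n (K : set 'M[C]_(m, n)) (x : 'M[C]_(m, n)) : Prop :=
  K x /\ forall y z, K y -> K z -> forall l : R, 0 < l < 1 ->
    x = (Complex l 0) *: y + (Complex (1 - l) 0) *: z -> y = z.

Definition ChoiExt s t r : set 'M[C]_(s * t) :=
  [set M | ChoiRank s t r M /\ extreme_point (Choi s t) M].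

Definition realify n (M : 'M[C]_n) : 'rV[R]_(n * n + n * n) :=
  row_mx (mxvec (map_mx (@complex.Re R) M)) (mxvec (map_mx (@complex.Im R) M)).

Fixpoint Ck_on m n (k : nat) (U : set 'rV[R]_m) (f : 'rV[R]_m -> 'rV[R]_n) : Prop :=
  match k with
  | 0 => forall x, U x -> continuous_at x f
  | k'.+1 => (forall x, U x -> continuous_at x f) /\
      forall i : 'I_m, (forall x, U x -> derivable f x (delta_mx 0 i)) /\
        Ck_on k' U (fun x => 'D_(delta_mx 0 i) f x)
  end.

Definition smooth_on m n (U : set 'rV[R]_m) (f : 'rV[R]_m -> 'rV[R]_n) : Prop :=
  forall k, Ck_on k U f.

Definition jacobian m n (f : 'rV[R]_m -> 'rV[R]_n) (x : 'rV[R]_m) : 'M[R]_(m, n) :=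
  \matrix_(i < m) 'D_(delta_mx 0 i) f x.

(* smooth embedded submanifold of R^N of dimension d (local regular level set) *)
Definition embedded_submanifold N (d : nat) (M : set 'rV[R]_N) : Prop :=
  (d <= N)%N /\
  forall p, M p -> exists U : set 'rV[R]_N, [/\ open U, U p &
    exists F : 'rV[R]_N -> 'rV[R]_(N - d),
      [/\ smooth_on U F,
          (forall x, U x -> \rank (jacobian F x) = (N - d)%N) &
          M `&` U = U `&` F @^-1` [set 0]]].

End ChoiDefs.
Arguments Choi R s t : clear implicits.
Arguments ChoiRank R s t r : clear implicits.
Arguments ChoiExt R s t r : clear implicits.
Arguments realify {R n}.

(* Main.v *)
Require Import Defs.
From HB Require Import structures.
From mathcomp Require Import all_boot all_order all_algebra.
From mathcomp Require Import complex mxtens spectral sesquilinear.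
From mathcomp Require Import boolp classical_sets reals topology normedtype derive.
From mathcomp Require Import ring lra zify.
Set Implicit Arguments. Unset Strict Implicit. Unset Printing Implicit Defensive.
Import Order.TTheory GRing.Theory Num.Theory.
Import numFieldNormedType.Exports.
Local Open Scope ring_scope.
Local Open Scope classical_set_scope.

(** A Choi state M is extreme iff no nonzero matrix supported on the support of M
    has vanishing partial trace: such a matrix may be taken Hermitian, and then M
    can be moved a little in both directions along it.  If p has rank r and
    W p W^* = 1, then near p the rows of W M span the support of every M of
    rank r, so extremality near p is injectivity of the linear map
    X |-> tr_B ((W M)^* X (W M)), an open condition on M.

    Near p the set of rank-r Choi states is cut out by M = M^*, by the vanishing of
    the Schur complement of W M W^*, and by tr_B M = 1/s.  These equations are
    independent at p: if K spans the kernel of p, then the derivative of the Schur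
    complement along a Hermitian V is K V K^*, and it vanishes on
    V = p (G (x) 1) + (G (x) 1) p, whose partial trace is 2 G / s.  Independence
    persists nearby, positivity follows from that of W M W^*, and a dimension
    count finishes the proof.  The state 1/s (x) |0><0| is extreme of rank s. *)

(** * Adjoints and positive semi-definite matrices *)

Section Adjoint.
Local Open Scope sesquilinear_scope.
Variable R : realType.
Local Notation C := (R[i]).

Lemma adjmxE m n (M : 'M[C]_(m, n)) i j : adjmx M i j = Num.conj (M j i).
Proof. by rewrite !mxE. Qed.

Lemma adjmxK m n : cancel (@adjmx R m n) (@adjmx R n m).
Proof. by move=> M; apply/matrixP=> i j; rewrite !adjmxE conjCK. Qed.

Lemma adjmxD m n (A B : 'M[C]_(m, n)) : adjmx (A + B) = adjmx A + adjmx B.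
Proof. by rewrite /adjmx linearD map_mxD. Qed.

Lemma adjmxN m n (A : 'M[C]_(m, n)) : adjmx (- A) = - adjmx A.
Proof. by rewrite /adjmx linearN map_mxN. Qed.

Lemma adjmxB m n (A B : 'M[C]_(m, n)) : adjmx (A - B) = adjmx A - adjmx B.
Proof. by rewrite adjmxD adjmxN. Qed.

Lemma adjmxZ m n a (A : 'M[C]_(m, n)) : adjmx (a *: A) = Num.conj a *: adjmx A.
Proof. by rewrite /adjmx linearZ map_mxZ. Qed.

Lemma adjmxM m n p (A : 'M[C]_(m, n)) (B : 'M[C]_(n, p)) :
  adjmx (A *m B) = adjmx B *m adjmx A.
Proof. by rewrite /adjmx trmx_mul map_mxM. Qed.

Lemma adjmx_scalar n a : adjmx (a%:M : 'M[C]_n) = (Num.conj a)%:M.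
Proof. by rewrite /adjmx tr_scalar_mx map_scalar_mx. Qed.

Lemma adjmx1 n : adjmx (1%:M : 'M[C]_n) = 1%:M.
Proof. by rewrite adjmx_scalar rmorph1. Qed.

Lemma adjmx0 m n : adjmx (0 : 'M[C]_(m, n)) = 0.
Proof. by rewrite /adjmx trmx0 map_mx0. Qed.

Lemma mxrank_adj m n (A : 'M[C]_(m, n)) : \rank (adjmx A) = \rank A.
Proof. by rewrite /adjmx mxrank_map mxrank_tr. Qed.

Lemma adjmx_inv n (A : 'M[C]_n) : adjmx (invmx A) = invmx (adjmx A).
Proof. by rewrite /adjmx trmx_inv map_invmx. Qed.

Lemma det_adjmx n (A : 'M[C]_n) : \det (adjmx A) = Num.conj (\det A).
Proof. by rewrite /adjmx det_map_mx det_tr. Qed.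

Lemma adjmx_adj n (A : 'M[C]_n) : adjmx (\adj A) = \adj (adjmx A).
Proof. by rewrite /adjmx trmx_adj map_mx_adj. Qed.

Lemma normsq_row n (v : 'rV[C]_n) : (v *m adjmx v) 0 0 = \sum_i `|v 0 i| ^+ 2.
Proof. by rewrite mxE; apply: eq_bigr => i _; rewrite adjmxE normCK. Qed.

Lemma normsq_row_eq0 n (v : 'rV[C]_n) : (v *m adjmx v) 0 0 = 0 -> v = 0.
Proof.
rewrite normsq_row => /eqP; rewrite psumr_eq0; last first.
  by move=> i _; rewrite exprn_ge0.
move=> /allP h; apply/rowP => i; rewrite mxE.
by have /(_ (mem_index_enum _)) /= := h i; rewrite expf_eq0 normr_eq0 => /eqP.
Qed.

Lemma psd_conj m n (M : 'M[C]_m) (X : 'M[C]_(m, n)) :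
  psdmx M -> psdmx (adjmx X *m M *m X).
Proof.
case=> hM pM; split; first by rewrite !adjmxM adjmxK -hM mulmxA.
by move=> v; have := pM (v *m adjmx X); rewrite adjmxM adjmxK !mulmxA.
Qed.

Lemma psd1 n : psdmx (1%:M : 'M[C]_n).
Proof.
split=> [|v]; first by rewrite adjmx1.
by rewrite mulmx1 normsq_row sumr_ge0 // => i _; rewrite exprn_ge0.
Qed.

Lemma psd_gram m n (X : 'M[C]_(m, n)) : psdmx (adjmx X *m X).
Proof. by have := psd_conj X (psd1 m); rewrite mulmx1. Qed.

(* The rows of [X] and [K] span the support and the kernel of [p]; [W] is a
   left inverse of [X^*] orthogonal to [K]. *)
Definition psd_frame n r m (p : 'M[C]_n) (X W : 'M[C]_(r, n)) (K : 'M[C]_(m, n)) :=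
  [/\ p = adjmx X *m X, W *m adjmx X = 1%:M, K *m adjmx X = 0 &
   [/\ adjmx X *m W + adjmx K *m K = 1%:M, K *m adjmx K = 1%:M &
    W *m adjmx K = 0]].

(** The spectral theorem in entrywise form, so that the sum over eigenvectors can be split by zero
    and nonzero eigenvalues. *)
Lemma psd_spectral n (p : 'M[C]_n) : psdmx p ->
  exists (P : 'M[C]_n) (d : 'I_n -> C),
   [/\ P *m adjmx P = 1%:M, adjmx P *m P = 1%:M,
      forall i, 0 <= d i &
      forall i j, p i j = \sum_a Num.conj (P a i) * d a * P a j].
Proof.
move=> [hp pp].
have nM : p \is normalmx by apply/normalmxP; rewrite -[_^t*]/(adjmx p) -hp.
have eqp := orthomx_spectralP nM.
have uP := spectral_unitarymx p.
set P := spectralmx p in eqp uP *; set sp := spectral_diag p in eqp; clearbody sp P.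
have PP : P *m adjmx P = 1%:M by exact/unitarymxP.
have PP' : adjmx P *m P = 1%:M by exact: mulmx1C.
rewrite (invmx_unitary uP) -[_^t*]/(adjmx P) in eqp.
exists P, (fun i => sp 0 i); split => //.
  (* The i-th eigenvalue is the quadratic form evaluated at the i-th row of [P]. *)
  move=> i; have := pp (row i P).
  have -> : (row i P *m p *m adjmx (row i P)) 0 0 = (P *m p *m adjmx P) i i.
    by rewrite -row_mul !mxE; apply: eq_bigr => k _; rewrite !mxE.
  rewrite eqp !mulmxA PP mul1mx -mulmxA PP mulmx1.
  by rewrite mxE eqxx mulr1n.
move=> i j; rewrite {1}eqp mxE; apply: eq_bigr => a _; congr (_ * _).
by rewrite mul_mx_diag !mxE.
Qed.

(** Eigenvectors with nonzero eigenvalue d, scaled by the square root of d or by its inverse, are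
    the rows of [X] and [W]; those with eigenvalue zero are the rows of [K]. The sizes are cardinals
    here and are identified through the rank afterwards. *)
Lemma psd_frame_card n (p : 'M[C]_n) : psdmx p ->
  exists r m (X W : 'M[C]_(r, n)) (K : 'M[C]_(m, n)),
    (r + m = n)%N /\ psd_frame p X W K.
Proof.
move=> /psd_spectral [P [d [PP PP' d0 hp]]].
have ortho a b : \sum_j P a j * Num.conj (P b j) = (a == b)%:R.
  by have /matrixP/(_ a b) := PP; rewrite !mxE => <-; apply: eq_bigr => j _; rewrite adjmxE.
have compl i j : \sum_a Num.conj (P a i) * P a j = (i == j)%:R.
  by have /matrixP/(_ i j) := PP'; rewrite !mxE => <-; apply: eq_bigr => a _; rewrite adjmxE.
pose Ip := [set a | d a != 0]%SET; pose In := (~: Ip)%SET.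
pose s a := sqrtC (d a).
have sc a : Num.conj (s a) = s a by apply: geC0_conj; rewrite sqrtC_ge0.
have s0 a : a \in Ip -> s a != 0 by rewrite inE sqrtC_eq0.
pose e (a : 'I_#|Ip|) : 'I_n := enum_val a.
pose f (a : 'I_#|In|) : 'I_n := enum_val a.
have eIp a : e a \in Ip by exact: enum_valP.
have fIn a : (f a \in Ip) = false by have := enum_valP a; rewrite inE => /negPf.
have ee a b : (e a == e b) = (a == b) by rewrite (inj_eq enum_val_inj).
have ff a b : (f a == f b) = (a == b) by rewrite (inj_eq enum_val_inj).
have ef a b : (e a == f b) = false.
  by apply/eqP => eab; have := fIn b; rewrite -eab eIp.
exists #|Ip|, #|In|, (\matrix_(a, j) (s (e a) * P (e a) j)),
  (\matrix_(a, j) ((s (e a))^-1 * P (e a) j)), (\matrix_(a, j) P (f a) j).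
split; first by rewrite cardsC card_ord.
split.
- apply/matrixP => i j; rewrite hp mxE (bigID (mem Ip)) /= [X in _ + X]big1 ?addr0; last first.
    by move=> a; rewrite inE negbK => /eqP ->; rewrite mulr0 mul0r.
  rewrite big_enum_val; apply: eq_bigr => a _; rewrite !mxE -/(e a) rmorphM /= sc.
  by rewrite -[d _]sqrtCK -/(s _); ring.
- apply/matrixP => a b; rewrite !mxE.
  rewrite (eq_bigr (fun j => (s (e a))^-1 * s (e b) * (P (e a) j * Num.conj (P (e b) j)))).
    rewrite -mulr_sumr ortho ee; case: eqP => [->|_]; last by rewrite mulr0.
    by rewrite mulr1 mulVf ?s0.
  by move=> j _; rewrite !mxE rmorphM /= sc; ring.
- apply/matrixP => a b; rewrite !mxE.
  rewrite (eq_bigr (fun j => s (e b) * (P (f a) j * Num.conj (P (e b) j)))).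
    by rewrite -mulr_sumr ortho eq_sym ef mulr0.
  by move=> j _; rewrite !mxE rmorphM /= sc; ring.
split.
- apply/matrixP => i j; rewrite !mxE -compl [RHS](bigID (mem Ip)) /=; congr (_ + _).
    rewrite [RHS]big_enum_val; apply: eq_bigr => a _; rewrite !mxE -/(e a) rmorphM /= sc.
    by rewrite mulrACA divff ?s0 // mul1r.
  rewrite [RHS](eq_bigl (mem In)); last by move=> a; rewrite /= finset.in_setC.
  by rewrite [RHS]big_enum_val; apply: eq_bigr => a _; rewrite !mxE.
- apply/matrixP => a b; rewrite !mxE -ff -ortho.
  by apply: eq_bigr => j _; rewrite !mxE.
- apply/matrixP => a b; rewrite !mxE.
  rewrite (eq_bigr (fun j => (s (e a))^-1 * (P (e a) j * Num.conj (P (f b) j)))).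
    by rewrite -mulr_sumr ortho ef mulr0.
  by move=> j _; rewrite !mxE mulrA.
Qed.

(** W X^* = 1 forces [X] to have full row rank, so p = X^* X has as rank the number of rows of
    [X]. *)
Lemma psd_frame_exists n (p : 'M[C]_n) : psdmx p ->
  exists (X W : 'M[C]_(\rank p, n)) (K : 'M[C]_(n - \rank p, n)),
    psd_frame p X W K.
Proof.
move=> pp; have [r [m [X [W [K [rm fr]]]]]] := psd_frame_card pp.
have er : r = \rank p.
  case: fr => [-> WX _ _].
  have rX : \rank X = r.
    have := mxrankM_maxr W (adjmx X); rewrite WX mxrank1 mxrank_adj => h.
    by apply/eqP; rewrite eqn_leq h rank_leq_row.
  by rewrite mxrankMfree ?mxrank_adj // -row_leq_rank rX.
have em : m = (n - \rank p)%N by rewrite -er -rm addKn.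
by rewrite -em -er; exists X, W, K.
Qed.

(** With p = X^* X, the quadratic form at v is the squared norm of v X^*. *)
Lemma psd_ker n (p : 'M[C]_n) (v : 'rV[C]_n) : psdmx p ->
  (v *m p *m adjmx v) 0 0 = 0 -> v *m p = 0.
Proof.
move=> /psd_frame_card [r [m [X [_ [_ [_ [-> _ _ _]]]]]]].
rewrite mulmxA -mulmxA => h.
by rewrite (@normsq_row_eq0 _ (v *m adjmx X)) ?mul0mx // adjmxM adjmxK.
Qed.

(* Diagonal dominance: |v E v^*| <= delta * sum |v_i||v_j| <= delta r |v|^2. *)
Lemma psd_near1 n (A : 'M[C]_n) : A = adjmx A ->
  (forall i j, `|(A - 1%:M) i j| <= (n.+1%:R)^-1) -> psdmx A.
Proof.
move=> hA small; split=> // v.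
set E := A - 1%:M in small *.
have -> : A = 1%:M + E by rewrite /E addrC subrK.
rewrite mulmxDr mulmx1 mulmxDl mxE normsq_row.
set N := \sum_i _.
have N0 : 0 <= N by rewrite sumr_ge0 // => i _; rewrite exprn_ge0.
have hE : E = adjmx E by rewrite /E adjmxB adjmx1 -hA.
(* The form of a Hermitian matrix is real, so a bound on its modulus bounds it from below. *)
have Er : (v *m E *m adjmx v) 0 0 \is Num.real.
  apply/CrealP; rewrite -adjmxE; congr (fun_of_matrix _ 0 0).
  by rewrite !adjmxM adjmxK -hE mulmxA.
suff h : `|(v *m E *m adjmx v) 0 0| <= N.
  by rewrite -lerBlDl sub0r; move: h; rewrite real_ler_norml // => /andP[].
have -> : (v *m E *m adjmx v) 0 0 = \sum_i \sum_j v 0 j * E j i * Num.conj (v 0 i).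
  by rewrite mxE; apply: eq_bigr => i _; rewrite adjmxE mxE mulr_suml.
apply: (le_trans (ler_norm_sum _ _ _)).
apply: (@le_trans _ _ (\sum_(i < n) \sum_(j < n)
    (n.+1%:R)^-1 * ((`|v 0 i| ^+ 2 + `|v 0 j| ^+ 2) / 2))).
  apply: ler_sum => i _; apply: (le_trans (ler_norm_sum _ _ _)).
  apply: ler_sum => j _; rewrite !normrM norm_conjC mulrAC mulrC.
  apply: ler_pM => //; first by rewrite mulr_ge0.
  (* The arithmetic-geometric mean inequality for |v_i| and |v_j|. *)
  rewrite -subr_ge0.
  have -> : (`|v 0 i| ^+ 2 + `|v 0 j| ^+ 2) / 2 - `|v 0 j| * `|v 0 i| =
     (`|v 0 i| - `|v 0 j|) ^+ 2 / 2 by field.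
  rewrite divr_ge0 // real_exprn_even_ge0 // rpredB // realE normr_ge0 //.
have -> : \sum_(i < n) \sum_(j < n)
    (n.+1%:R)^-1 * ((`|v 0 i| ^+ 2 + `|v 0 j| ^+ 2) / 2) = n.+1%:R^-1 * (n%:R * N).
  under eq_bigr do rewrite -mulr_sumr.
  rewrite -mulr_sumr; congr (_ * _).
  under eq_bigr do rewrite -mulr_suml big_split /= sumr_const card_ord.
  rewrite -mulr_suml big_split /= sumr_const card_ord sumrMnl -/N -mulr_natl.
  by field.
rewrite mulrA ler_piMl // mulrC ler_pdivrMr ?ltr0Sn // mul1r ler_nat //.
Qed.

End Adjoint.

(** * Polynomial functions of real variables with complex values *)

Section PolynomialFunctions.
Variables (R : realType) (N : nat).
Local Notation C := (R[i]).
Local Notation V := ('rV[R]_N).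

(** An inductive class: continuity, derivatives and conjugation are all treated by induction on the
    construction of the polynomial. *)
Inductive cpoly : (V -> C) -> Prop :=
| cpoly_cst c : cpoly (fun=> c)
| cpoly_coord i : cpoly (fun x => real_complex R (x 0 i))
| cpolyD f g : cpoly f -> cpoly g -> cpoly (fun x => f x + g x)
| cpolyM f g : cpoly f -> cpoly g -> cpoly (fun x => f x * g x).

Lemma cpoly_ext f g : f =1 g -> cpoly f -> cpoly g.
Proof. by move=> /funext ->. Qed.

Lemma cpolyZ c f : cpoly f -> cpoly (fun x => c * f x).
Proof. by apply: cpolyM; exact: cpoly_cst. Qed.

Lemma cpolyN f : cpoly f -> cpoly (fun x => - f x).
Proof. by move=> /(cpolyZ (-1)); apply: cpoly_ext => x; rewrite mulN1r. Qed.

Lemma cpoly_sum I (s : seq I) P (F : I -> V -> C) : (forall i, cpoly (F i)) ->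
  cpoly (fun x => \sum_(i <- s | P i) F i x).
Proof.
move=> h; elim: s => [|i s IH].
  by apply: cpoly_ext (cpoly_cst 0) => x; rewrite big_nil.
case Pi : (P i).
  by apply: cpoly_ext (cpolyD (h i) IH) => x; rewrite big_cons Pi.
by apply: cpoly_ext IH => x; rewrite big_cons Pi.
Qed.

Lemma cpoly_prod I (s : seq I) P (F : I -> V -> C) : (forall i, cpoly (F i)) ->
  cpoly (fun x => \prod_(i <- s | P i) F i x).
Proof.
move=> h; elim: s => [|i s IH].
  by apply: cpoly_ext (cpoly_cst 1) => x; rewrite big_nil.
case Pi : (P i).
  by apply: cpoly_ext (cpolyM (h i) IH) => x; rewrite big_cons Pi.
by apply: cpoly_ext IH => x; rewrite big_cons Pi.
Qed.

(** The coordinates are real, so conjugation changes only the constants. *)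
Lemma cpoly_conj f : cpoly f -> cpoly (fun x => Num.conj (f x)).
Proof.
elim=> [c|i|g h _ cg _ ch|g h _ cg _ ch].
- exact: cpoly_cst.
- by apply: cpoly_ext (cpoly_coord i) => x; rewrite -[RHS]/(conjc _) conjc_real.
- by apply: cpoly_ext (cpolyD cg ch) => x; rewrite rmorphD.
- by apply: cpoly_ext (cpolyM cg ch) => x; rewrite rmorphM.
Qed.

Definition mxcpoly m n (A : V -> 'M[C]_(m, n)) :=
  forall i j, cpoly (fun x => A x i j).

Lemma mxcpoly_cst m n (A : 'M[C]_(m, n)) : mxcpoly (fun=> A).
Proof. by move=> i j; exact: cpoly_cst. Qed.

Lemma mxcpolyD m n (A B : V -> 'M[C]_(m, n)) : mxcpoly A -> mxcpoly B ->
  mxcpoly (fun x => A x + B x).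
Proof.
by move=> hA hB i j; apply: cpoly_ext (cpolyD (hA i j) (hB i j)) => x; rewrite mxE.
Qed.

Lemma mxcpolyN m n (A : V -> 'M[C]_(m, n)) : mxcpoly A -> mxcpoly (fun x => - A x).
Proof. by move=> hA i j; apply: cpoly_ext (cpolyN (hA i j)) => x; rewrite mxE. Qed.

Lemma mxcpolyZ m n (a : V -> C) (A : V -> 'M[C]_(m, n)) : cpoly a -> mxcpoly A ->
  mxcpoly (fun x => a x *: A x).
Proof. by move=> ha hA i j; apply: cpoly_ext (cpolyM ha (hA i j)) => x; rewrite mxE. Qed.

Lemma mxcpolyM m n p (A : V -> 'M[C]_(m, n)) (B : V -> 'M[C]_(n, p)) :
  mxcpoly A -> mxcpoly B -> mxcpoly (fun x => A x *m B x).
Proof.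
move=> hA hB i j.
have h : cpoly (fun x => \sum_k A x i k * B x k j).
  by apply: cpoly_sum => k; exact: cpolyM.
by apply: cpoly_ext h => x; rewrite mxE.
Qed.

Lemma mxcpoly_adjmx m n (A : V -> 'M[C]_(m, n)) :
  mxcpoly A -> mxcpoly (fun x => adjmx (A x)).
Proof. by move=> hA i j; apply: cpoly_ext (cpoly_conj (hA j i)) => x; rewrite !mxE. Qed.

Lemma cpoly_det n (A : V -> 'M[C]_n) : mxcpoly A -> cpoly (fun x => \det (A x)).
Proof.
move=> hA; apply: cpoly_sum => s; apply: cpolyZ.
by apply: cpoly_prod => i.
Qed.

Lemma mxcpoly_adj n (A : V -> 'M[C]_n) : mxcpoly A -> mxcpoly (fun x => \adj (A x)).
Proof.
move=> hA i j.
have h : cpoly (fun x => (-1) ^+ (j + i) * \det (row' j (col' i (A x)))).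
  apply: cpolyZ; apply: cpoly_det => k l.
  by apply: cpoly_ext (hA (lift j k) (lift i l)) => x; rewrite !mxE.
by apply: cpoly_ext h => x; rewrite mxE.
Qed.

(** The argument is a real vector, so the derivative is taken on the real and imaginary parts
    separately. *)
Definition cder (f : V -> C) (x v : V) (b : C) :=
  is_derive x v (fun y => complex.Re (f y)) (complex.Re b) /\
  is_derive x v (fun y => complex.Im (f y)) (complex.Im b).

Lemma cder_ext f g x v b : f =1 g -> cder f x v b -> cder g x v b.
Proof. by move=> /funext ->. Qed.

Lemma cder_cst c x v : cder (fun=> c) x v 0.
Proof. by split; exact: is_derive_cst. Qed.

Lemma cder_coord i x v :
  cder (fun y => real_complex R (y 0 i)) x v (real_complex R (v 0 i)).
Proof.
split; last exact: is_derive_cst.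
have dl := @differentiable_coord R _ _ x 0 i.
apply: DeriveDef; first exact: diff_derivable.
(* The difference quotient of a coordinate is constant for nonzero h. *)
apply: cvg_lim => //=; apply: cvg_near_cst; near=> h.
rewrite !mxE addrK; rewrite /GRing.scale /= mulKf //.
by near: h; exact: nbhs_dnbhs_neq.
Unshelve. all: by end_near. Qed.

Lemma cReD (a b : C) : complex.Re (a + b) = complex.Re a + complex.Re b.
Proof. by case: a; case: b. Qed.

Lemma cImD (a b : C) : complex.Im (a + b) = complex.Im a + complex.Im b.
Proof. by case: a; case: b. Qed.

Lemma cRe_sum I (s : seq I) P (F : I -> C) :
  complex.Re (\sum_(i <- s | P i) F i) = \sum_(i <- s | P i) complex.Re (F i).
Proof. exact: (big_morph _ cReD (erefl _)). Qed.

Lemma cReM (a b : C) : complex.Re (a * b) =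
  complex.Re a * complex.Re b - complex.Im a * complex.Im b.
Proof. by case: a; case: b. Qed.

Lemma cImM (a b : C) : complex.Im (a * b) =
  complex.Re a * complex.Im b + complex.Im a * complex.Re b.
Proof. by case: a; case: b. Qed.

Lemma cderD f g x v a b : cder f x v a -> cder g x v b ->
  cder (fun y => f y + g y) x v (a + b).
Proof.
move=> [fr fi] [gr gi]; split.
  rewrite (funext (fun y => cReD (f y) (g y))) cReD; exact: is_deriveD fr gr.
rewrite (funext (fun y => cImD (f y) (g y))) cImD; exact: is_deriveD fi gi.
Qed.

Lemma cderM f g x v a b : cder f x v a -> cder g x v b ->
  cder (fun y => f y * g y) x v (f x * b + a * g x).
Proof.
move=> [fr fi] [gr gi]; split.
  rewrite (funext (fun y => cReM (f y) (g y))).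
  apply: (is_derive_eq (is_deriveB (is_deriveM fr gr) (is_deriveM fi gi))).
  by rewrite cReD !cReM /GRing.scale /=; ring.
rewrite (funext (fun y => cImM (f y) (g y))).
apply: (is_derive_eq (is_deriveD (is_deriveM fr gi) (is_deriveM fi gr))).
by rewrite cImD !cImM /GRing.scale /=; ring.
Qed.

(** The partial derivatives are again polynomials, and linearity in v is built into the formula;
    this is what allows differentiation to be iterated. *)
Lemma cpoly_deriv f : cpoly f -> exists g : 'I_N -> V -> C,
  (forall i, cpoly (g i)) /\
  forall x v, cder f x v (\sum_i real_complex R (v 0 i) * g i x).
Proof.
elim=> [c|i|f1 f2 _ [g1 [p1 d1]] _ [g2 [p2 d2]]|f1 f2 c1 [g1 [p1 d1]] c2 [g2 [p2 d2]]].
- exists (fun _ _ => 0); split=> [i|x v]; first exact: cpoly_cst.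
  rewrite big1; [exact: cder_cst|by move=> i _; rewrite mulr0].
- exists (fun j _ => (i == j)%:R); split=> [j|x v]; first exact: cpoly_cst.
  rewrite (bigD1 i) //= eqxx mulr1 big1 ?addr0; first exact: cder_coord.
  by move=> j ji; rewrite eq_sym (negPf ji) mulr0.
- exists (fun i x => g1 i x + g2 i x); split=> [i|x v]; first exact: cpolyD.
  under eq_bigr do rewrite mulrDr.
  by rewrite big_split; apply: cderD.
- exists (fun i x => f1 x * g2 i x + g1 i x * f2 x); split=> [i|x v].
    by apply: cpolyD; apply: cpolyM.
  rewrite (_ : \sum_i _ = f1 x * (\sum_i real_complex R (v 0 i) * g2 i x) +
     (\sum_i real_complex R (v 0 i) * g1 i x) * f2 x); first exact: cderM.
  rewrite mulr_sumr mulr_suml -big_split; apply: eq_bigr => i _ /=.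
  ring.
Qed.

Lemma cpoly_continuous f : cpoly f ->
  continuous (fun x => complex.Re (f x)) /\ continuous (fun x => complex.Im (f x)).
Proof.
elim=> [c|i|f1 f2 _ [r1 i1] _ [r2 i2]|f1 f2 _ [r1 i1] _ [r2 i2]].
- by split; exact: cst_continuous.
- by split=> x; [exact: (@coord_continuous R 1 N 0 i x)|exact: cst_continuous].
- split=> x.
    rewrite (funext (fun y => cReD (f1 y) (f2 y))); exact: continuousD (r1 x) (r2 x).
  rewrite (funext (fun y => cImD (f1 y) (f2 y))); exact: continuousD (i1 x) (i2 x).
- split=> x.
    rewrite (funext (fun y => cReM (f1 y) (f2 y))).
    exact: continuousB (continuousM (r1 x) (r2 x)) (continuousM (i1 x) (i2 x)).
  rewrite (funext (fun y => cImM (f1 y) (f2 y))).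
  exact: continuousD (continuousM (r1 x) (i2 x)) (continuousM (i1 x) (r2 x)).
Qed.

Lemma open_cpoly_lt f c : cpoly f -> open [set x | complex.Re (f x) < c].
Proof.
move=> /cpoly_continuous [cf _].
apply: (@open_comp _ _ (fun x => complex.Re (f x)) [set y | y < c]).
  by move=> x _; exact: cf.
exact: open_lt.
Qed.

(** f is nonzero exactly where the polynomial - |f|^2 is negative. *)
Lemma open_cpoly_neq0 f : cpoly f -> open [set x | f x != 0].
Proof.
move=> pf.
have E z : (complex.Re (- (z * Num.conj z)) < 0) = (z != 0 :> C).
  rewrite -normCK raddfN oppr_lt0 -ltcR RRe_real ?ger0_real ?exprn_ge0 //.
  by rewrite lt0r exprn_ge0 // andbT sqrf_eq0 normr_eq0.
have -> : [set x | f x != 0] = [set x | complex.Re (- (f x * Num.conj (f x))) < 0].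
  by apply/seteqP; split => x /=; rewrite E.
by apply: open_cpoly_lt; apply: cpolyN; apply: cpolyM => //; exact: cpoly_conj.
Qed.

(** Real polynomial maps, encoded as real parts so that the results on complex polynomials apply to
    each coordinate. *)
Definition rpoly k (F : V -> 'rV[R]_k) :=
  forall j, exists f, cpoly f /\ forall x, F x 0 j = complex.Re (f x).

Lemma rpoly_continuous k (F : V -> 'rV[R]_k) : rpoly F -> continuous F.
Proof.
move=> hF x; apply/(@cvgrPdist_le _ _ _ _ (nbhs_filter x)) => e e0.
have h : \forall y \near nbhs x, forall j, `|F x 0 j - F y 0 j| <= e.
  apply: (filter_forall (nbhs_filter x)) => j.
  have [f [/cpoly_continuous [cf _] Ff]] := hF j.
  have := (@cvgrPdist_le _ _ _ _ (nbhs_filter x) _ _).1 (cf x) e e0.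
  by apply: (@filterS _ _ (nbhs_filter x)) => y; rewrite !Ff.
apply: (@filterS _ _ (nbhs_filter x)) h => y h.
rewrite /Num.Def.normr/= mx_normrE (bigmax_le _ (ltW e0))//= => i _.
by rewrite !mxE/= [i.1]ord1 h.
Qed.

Lemma rpoly_derive k (F : V -> 'rV[R]_k) : rpoly F ->
  exists G : 'I_N -> V -> 'rV[R]_k, (forall i, rpoly (G i)) /\
   forall x v, derivable F x v /\ 'D_v F x = \sum_i v 0 i *: G i x.
Proof.
move=> hF.
have /choice [g hg] : forall j, exists g : 'I_N -> V -> C, (forall i, cpoly (g i)) /\
  forall x v, is_derive x v (fun y => F y 0 j)
    (complex.Re (\sum_i real_complex R (v 0 i) * g i x)).
  move=> j; have [f [/cpoly_deriv [g [pg dg]] Ff]] := hF j.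
  exists g; split=> // x v; have [dr _] := dg x v.
  by rewrite (_ : (fun y => _) = (fun y => complex.Re (f y))) //; apply/funext.
exists (fun i x => \row_j complex.Re (g j i x)); split=> [i j|x v].
  by exists (g j i); split=> [|x]; [have [] := hg j|rewrite mxE].
have dF : derivable F x v.
  by apply/derivable_mxP => i j; rewrite ord1; have [_ /(_ x v) []] := hg j.
split=> //; rewrite derive_mx //; apply/rowP => j; rewrite mxE summxE.
have [_ /(_ x v) d] := hg j; rewrite derive_val cRe_sum; apply: eq_bigr => i _.
by rewrite !mxE cReM /= mul0r subr0.
Qed.

Lemma rpoly_smooth k (U : set V) (F : V -> 'rV[R]_k) : rpoly F -> smooth_on U F.
Proof.
move=> hF l; elim: l F hF => [|l IH] F hF /=.
  by move=> x _; exact: rpoly_continuous.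
split=> [x _|i]; first exact: rpoly_continuous.
have [G [pG dG]] := rpoly_derive hF.
split=> [x _|]; first by have [] := dG x (delta_mx 0 i).
apply: IH => j; have [f [pf hf]] := pG i j; exists f; split=> // x.
have [_ ->] := dG x (delta_mx 0 i); rewrite -hf summxE (bigD1 i) //= !mxE !eqxx mul1r.
by rewrite big1 ?addr0 // => a ai; rewrite !mxE (negPf ai) mul0r.
Qed.

(** The first half turns surjectivity of the derivative into full rank of the Jacobian; the second
    makes full rank an open condition. *)
Lemma rpoly_jacobian k (F : V -> 'rV[R]_k) : rpoly F ->
  (forall x v, v *m Defs.jacobian F x = 'D_v F x) /\
  mxcpoly (fun x => map_mx (real_complex R) (Defs.jacobian F x)).
Proof.
move=> hF; have [G [pG dG]] := rpoly_derive hF.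
have jE x i : 'D_(delta_mx 0 i) F x = G i x.
  have [_ ->] := dG x (delta_mx 0 i); rewrite (bigD1 i) //= !mxE !eqxx scale1r.
  by rewrite big1 ?addr0 // => a ai; rewrite !mxE (negPf ai) scale0r.
split=> [x v|i j].
  have [_ ->] := dG x v; rewrite mulmx_sum_row; apply: eq_bigr => i _.
  by rewrite /Defs.jacobian rowK jE.
have [f [pf hf]] := pG i j.
(* The real part is half the sum of f and its conjugate. *)
apply: (@cpoly_ext (fun x => 2^-1 * (f x + Num.conj (f x)))); last first.
  by apply: cpolyZ; apply: cpolyD => //; exact: cpoly_conj.
by move=> x; rewrite !mxE jE hf -[Num.conj _]/(conjc _) ReJ_add mulrC.
Qed.

End PolynomialFunctions.

(** * Partial trace and extreme points *)

Section PartialTrace.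
Variables (R : realType) (s t : nat).
Local Notation C := (R[i]).
Local Notation ptr := (@ptraceB R s t).

Lemma ptraceB_is_linear : linear ptr.
Proof.
move=> a A B; apply/matrixP => i j; rewrite !mxE mulr_sumr -big_split.
by apply: eq_bigr => k _; rewrite !mxE.
Qed.
HB.instance Definition _ := GRing.isLinear.Build C 'M[C]_(s * t) 'M[C]_s _ ptr
  ptraceB_is_linear.

Lemma ptraceB_adj M : ptr (adjmx M) = adjmx (ptr M).
Proof.
apply/matrixP => i j; rewrite !mxE rmorph_sum.
by apply: eq_bigr => k _; rewrite !mxE.
Qed.

Lemma sum_mxtens (f : 'I_(s * t) -> C) :
  \sum_k f k = \sum_i \sum_j f (mxtens_index (i, j)).
Proof.
rewrite pair_bigA /= (reindex (@mxtens_index s t)) /=.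
  by apply: eq_bigr => -[].
by exists (@mxtens_unindex s t) => k _; [exact: mxtens_indexK|exact: mxtens_unindexK].
Qed.

(** A matrix acting on system A alone does not touch the index summed by the partial trace. *)
Lemma ptraceB_tensl (G : 'M[C]_s) M : ptr ((G *t 1%:M) *m M) = G *m ptr M.
Proof.
apply/matrixP => i j; rewrite !mxE.
under eq_bigr do rewrite mxE sum_mxtens.
rewrite exchange_big; apply: eq_bigr => k _; rewrite mxE mulr_sumr.
apply: eq_bigr => l _; rewrite (bigD1 l) //= tensmxE mxE eqxx mulr1 big1 ?addr0 //.
by move=> l' l'l; rewrite tensmxE mxE eq_sym (negPf l'l) mulr0 mul0r.
Qed.

Lemma adjmx_tens1 (G : 'M[C]_s) : adjmx (G *t (1%:M : 'M[C]_t)) = adjmx G *t 1%:M.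
Proof. by rewrite /adjmx trmx_tens map_mxT trmx1 map_mx1. Qed.

Lemma ptraceB_tensr (G : 'M[C]_s) M : ptr (M *m (G *t 1%:M)) = ptr M *m G.
Proof.
apply: (can_inj (@adjmxK R s s)).
by rewrite -ptraceB_adj !adjmxM adjmx_tens1 ptraceB_tensl ptraceB_adj.
Qed.

(* The two inclusions say that [H] maps the support of [M] to itself and kills its
   orthogonal complement. *)
Definition ptrace_faithful (M : 'M[C]_(s * t)) := forall H : 'M[C]_(s * t),
  (H <= M)%MS -> (adjmx H <= M)%MS -> ptr H = 0 -> H = 0.

(** Y Q = 1 makes Q Y act as the identity on the row space of [Y]; this is applied to [H] and to its
    adjoint. *)
Lemma compress_support n r (Y : 'M[C]_(r, n)) (Q : 'M[C]_(n, r)) (H : 'M[C]_n) :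
  Y *m Q = 1%:M -> (H <= Y)%MS -> (adjmx H <= Y)%MS ->
  H = adjmx Y *m (adjmx Q *m H *m Q) *m Y.
Proof.
move=> YQ /submxP [T HT] /submxP [T' HT'].
have h1 : H *m Q *m Y = H by rewrite HT -(mulmxA T) YQ mulmx1.
have h2 : adjmx Y *m adjmx Q *m H = H.
  apply: (can_inj (@adjmxK R n n)); rewrite !adjmxM !adjmxK HT'.
  by rewrite mulmxA -(mulmxA T') YQ mulmx1.
by rewrite !mulmxA -!mulmxA (mulmxA H) h1 mulmxA h2.
Qed.

(** The matrices supported on the support of [M] are the Y^* X Y, each for a unique X. *)
Lemma ptrace_faithfulP r (Y : 'M[C]_(r, s * t)) (M : 'M[C]_(s * t)) :
  row_free Y -> (Y :=: M)%MS ->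
  ptrace_faithful M <-> (forall X : 'M[C]_r, ptr (adjmx Y *m X *m Y) = 0 -> X = 0).
Proof.
move=> /row_freeP [Q YQ] YM; split=> h.
  move=> X trX.
  have : adjmx Y *m X *m Y = 0.
    by apply: h; rewrite // -YM ?adjmxM ?adjmxK ?mulmxA submxMl.
  move=> /(congr1 (fun Z => adjmx Q *m Z *m Q)); rewrite mulmx0 mul0mx.
  by rewrite !mulmxA -adjmxM YQ adjmx1 mul1mx -!mulmxA YQ mulmx1.
move=> H; rewrite -!YM => HY HY' trH.
rewrite (compress_support YQ HY HY') [X in adjmx Y *m X]h ?mulmx0 ?mul0mx //.
by rewrite -compress_support.
Qed.

(** On the kernel of the sum both nonnegative forms vanish, so this kernel lies in that of [y]; the
    row spaces are included the other way. *)
Lemma psd_convex_sub n (y z : 'M[C]_n) (a b : C) : psdmx y -> psdmx z ->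
  0 < a -> 0 < b -> (y <= (a *: y + b *: z)%R)%MS.
Proof.
move=> py pz a0 b0; set M := _ + _.
have hM : M = adjmx M.
  by case: py pz => hy _ [hz _]; rewrite /M adjmxD !adjmxZ -hy -hz !geC0_conj // ltW.
rewrite submxE; apply/eqP.
set c := cokermx M.
have cM : adjmx c *m M = 0 by rewrite {1}hM -adjmxM mulmx_coker adjmx0.
case: (py) => hy _.
apply: (can_inj (@adjmxK R _ _)); rewrite adjmxM -hy adjmx0.
apply/row_matrixP => i; rewrite row_mul row0; apply: psd_ker => //.
set v := row i _.
have vM : (v *m M *m adjmx v) 0 0 = 0 by rewrite -row_mul cM row0 mul0mx mxE.
have yv := (py.2 v); have zv := (pz.2 v).
have eM : (v *m M *m adjmx v) 0 0 =
    a * (v *m y *m adjmx v) 0 0 + b * (v *m z *m adjmx v) 0 0.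
  by rewrite /M mulmxDr mulmxDl -!scalemxAr -!scalemxAl mxE; congr (_ + _); rewrite mxE.
move/eqP: vM; rewrite eM.
rewrite paddr_eq0 ?mulr_ge0 // ?ltW // mulf_eq0 gt_eqF //=.
by case/andP => /eqP.
Qed.

Lemma psdZ n (a : C) (M : 'M[C]_n) : 0 <= a -> psdmx M -> psdmx (a *: M).
Proof.
move=> a0 [hM pM]; split; first by rewrite adjmxZ -hM geC0_conj.
by move=> v; rewrite -scalemxAr -scalemxAl mxE mulr_ge0.
Qed.

Lemma psd_perturb r (Z : 'M[C]_r) : Z = adjmx Z ->
  exists e : C, 0 < e /\ psdmx (1%:M + e *: Z) /\ psdmx (1%:M - e *: Z).
Proof.
(* [S] bounds every entry of [Z], and the summand 1 keeps it positive when [Z] is zero; dividing by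
   it meets the entrywise bound of [psd_near1]. *)
move=> hZ; pose S := 1 + \sum_i \sum_j `|Z i j|.
have sum0 : 0 <= \sum_i \sum_j `|Z i j| by rewrite !sumr_ge0 // => i _; rewrite sumr_ge0.
have S0 : 0 < S by rewrite ltr_wpDr.
pose e := r.+1%:R^-1 / S.
have e0 : 0 < e by rewrite divr_gt0 // invr_gt0 ltr0Sn.
have ZS i j : `|Z i j| <= S.
  rewrite /S (bigD1 i) //= (bigD1 j) //= addrCA -addrA lerDl addr_ge0 ?sumr_ge0 //.
    by rewrite addr_ge0 // sumr_ge0 // => k _; rewrite sumr_ge0.
have eZ i j : `|e * Z i j| <= r.+1%:R^-1.
  rewrite normrM gtr0_norm // /e -mulrA ler_piMr ?invr_ge0 //.
  by rewrite mulrC ler_pdivrMr // mul1r.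
have hE (e' : C) : 0 <= e' -> adjmx (e' *: Z) = e' *: Z.
  by move=> e'0; rewrite adjmxZ -hZ geC0_conj.
exists e; split=> //; split; apply: psd_near1.
- by rewrite adjmxD adjmx1 hE // ltW.
- by move=> i j; rewrite addrC addKr mxE.
- by rewrite adjmxB adjmx1 hE // ltW.
- by move=> i j; rewrite addrC addKr !mxE normrN.
Qed.

(** If M is a proper mixture of y and z, then y - z is supported on the support of M and has zero
    partial trace. Conversely, a Hermitian H of this kind makes M the midpoint of the Choi states M
    + e H and M - e H. *)
Lemma extreme_faithful (M : 'M[C]_(s * t)) : Choi R s t M ->
  (extreme_point (Choi R s t) M <-> ptrace_faithful M).
Proof.
move=> cM; have [pM trM] := cM; split; last first.
  move=> faith; split=> // y z [py try] [pz trz] l /andP [l0 l1] eM.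
  have a0 : 0 < Complex l 0 by rewrite ltcE /= eqxx.
  have b0 : 0 < Complex (1 - l) 0 by rewrite ltcE /= eqxx subr_gt0.
  have yM : (y <= M)%MS by rewrite eM psd_convex_sub.
  have zM : (z <= M)%MS by rewrite eM addrC psd_convex_sub.
  apply/eqP; rewrite -subr_eq0; apply/eqP; apply: faith.
  - by rewrite addmx_sub // eqmx_opp.
  - by rewrite adjmxB -py.1 -pz.1 addmx_sub // eqmx_opp.
  - by rewrite linearB /= try trz subrr.
move=> [_ ext].
have herm0 H : H = adjmx H -> (H <= M)%MS -> ptr H = 0 -> H = 0.
  move=> hH HM trH.
  have [r [m [X [W [K [_ [eM WX _ _]]]]]]] := psd_frame_card pM.
  have XW : X *m adjmx W = 1%:M by rewrite -(adjmxK X) -adjmxM WX adjmx1.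
  have HX : (H <= X)%MS by apply: submx_trans HM _; rewrite eM submxMl.
  have HX' : (adjmx H <= X)%MS by rewrite -hH.
  (* H = X^* Z X and M = X^* X, so perturbing M by H amounts to perturbing the identity by [Z]. *)
  have := compress_support XW HX HX'; set Z := (_ *m _ *m adjmx W) => HZ.
  have hZ : Z = adjmx Z by rewrite /Z !adjmxM !adjmxK -hH !mulmxA.
  have [e [e0 [p1 p2]]] := psd_perturb hZ.
  have E1 : adjmx X *m (1%:M + e *: Z) *m X = M + e *: H.
    by rewrite mulmxDr mulmx1 mulmxDl -eM -scalemxAr -scalemxAl -HZ.
  have E2 : adjmx X *m (1%:M - e *: Z) *m X = M - e *: H.
    by rewrite mulmxBr mulmx1 mulmxBl -eM -scalemxAr -scalemxAl -HZ.
  have c1 : Choi R s t (M + e *: H).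
    split; first by rewrite -E1; exact: psd_conj.
    by rewrite linearD linearZ /= trH scaler0 addr0.
  have c2 : Choi R s t (M - e *: H).
    split; first by rewrite -E2; exact: psd_conj.
    by rewrite linearB linearZ /= trH scaler0 subr0.
  have half : (0 : R) < (2^-1 : R) < (1 : R) by lra.
  have hc : Complex (1 - 2^-1) 0 = Complex (2^-1) 0 :> C by congr Complex; field.
  have hc2 : Complex (2^-1) 0 = 2^-1 :> C.
    by rewrite -[LHS]/(real_complex R 2^-1) fmorphV rmorph_nat.
  have eMM : M = Complex (2^-1) 0 *: (M + e *: H) + Complex (1 - 2^-1) 0 *: (M - e *: H).
    rewrite hc hc2 -scalerDr addrACA subrr addr0 scalerDr -scalerDl.
    by rewrite (_ : 2^-1 + 2^-1 = 1) ?scale1r //; field.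
  have /eqP := ext _ _ c1 c2 _ half eMM.
  rewrite -subr_eq0 opprD opprK addrACA subrr add0r -scalerDl scaler_eq0.
  by rewrite gt_eqF ?addr_gt0 //= => /eqP.
(* A general H is reduced to the Hermitian matrices H + H^* and i H - i H^* with the same support
   condition and zero partial trace. *)
move=> H HM HM' trH.
have trH' : ptr (adjmx H) = 0 by rewrite ptraceB_adj trH adjmx0.
have H1 : H + adjmx H = 0.
  apply: herm0; rewrite ?addmx_sub //; first by rewrite adjmxD adjmxK addrC.
  by rewrite linearD /= trH trH' addr0.
have H2 : 'i *: (H - adjmx H) = 0.
  apply: herm0.
  - by rewrite adjmxZ adjmxB adjmxK conjCi scaleNr -scalerN opprB.
  - by rewrite scalemx_sub // addmx_sub // eqmx_opp.
  - by rewrite linearZ linearB /= trH trH' subrr scaler0.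
move/eqP: H2; rewrite scaler_eq0 (negPf (neq0Ci _)) /= subr_eq0 => /eqP H2.
move: H1; rewrite -H2 -{1 2}[H]scale1r -scalerDl => /eqP; rewrite scaler_eq0.
by rewrite gt_eqF ?addr_gt0 //= => /eqP.
Qed.

(** Named so as to carry a linear structure: its matrix [lin_mx] has r^2 rows and s^2 columns, and
    injectivity becomes row freeness. *)
Definition ptrace_lift r (Y : 'M[C]_(r, s * t)) (X : 'M[C]_r) : 'M[C]_s :=
  ptr (adjmx Y *m X *m Y).

Lemma ptrace_lift_is_linear r Y : linear (@ptrace_lift r Y).
Proof.
move=> a A B; rewrite /ptrace_lift mulmxDr mulmxDl linearD.
by rewrite -scalemxAr -scalemxAl linearZ.
Qed.
HB.instance Definition _ r Y := GRing.isLinear.Build C 'M[C]_r 'M[C]_s _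
  (@ptrace_lift r Y) (@ptrace_lift_is_linear r Y).

Lemma row_free_ptrace_lift r (Y : 'M[C]_(r, s * t)) :
  row_free (lin_mx (ptrace_lift Y)) <->
  (forall X : 'M[C]_r, ptr (adjmx Y *m X *m Y) = 0 -> X = 0).
Proof.
split=> [/row_freeP [G hG] X trX|h].
  apply: (can_inj mxvecK); rewrite linear0 -[mxvec X]mulmx1 -hG mulmxA.
  by rewrite mul_vec_lin /= /ptrace_lift trX linear0 mul0mx.
apply/inj_row_free => v; rewrite -[v]vec_mxK mul_vec_lin /= => e0.
rewrite (h (vec_mx v)) ?linear0 //.
by apply: (can_inj mxvecK); rewrite linear0.
Qed.

Lemma mxcpoly_ptrace N (A : 'rV[R]_N -> 'M[C]_(s * t)) :
  mxcpoly A -> mxcpoly (fun x => ptr (A x)).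
Proof.
move=> hA i j.
have h : cpoly (fun x => \sum_k A x (mxtens_index (i, k)) (mxtens_index (j, k))).
  by apply: cpoly_sum.
by apply: cpoly_ext h => x; rewrite mxE.
Qed.

Lemma mxcpoly_ptrace_lift N r (A : 'rV[R]_N -> 'M[C]_(r, s * t)) :
  mxcpoly A -> mxcpoly (fun x => lin_mx (ptrace_lift (A x))).
Proof.
move=> hA i j; case/mxvec_indexP: j => a b.
have h : mxcpoly (fun x => ptrace_lift (A x) (vec_mx (delta_mx 0 i))).
  apply: mxcpoly_ptrace; apply: mxcpolyM => //; apply: mxcpolyM.
    exact: mxcpoly_adjmx.
  exact: mxcpoly_cst.
by apply: cpoly_ext (h a b) => x; rewrite [RHS]mxE /= mxvecE.
Qed.

End PartialTrace.

(** * Schur complements *)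

Section SchurReduction.
Variables (R : realType) (n r m : nat).
Local Notation C := (R[i]).
Variables (p : 'M[C]_n) (X W : 'M[C]_(r, n)) (K : 'M[C]_(m, n)).
Hypothesis fr : psd_frame p X W K.

(** Compression to the support of [p], normalised to be the identity at [p] itself. *)
Definition corner (M : 'M[C]_n) : 'M[C]_r := W *m M *m adjmx W.

(* The Schur complement of the corner, multiplied by its determinant so as to be polynomial. *)
Definition schur_red (M : 'M[C]_n) : 'M[C]_n :=
  \det (corner M) *: M - M *m adjmx W *m \adj (corner M) *m (W *m M).

(** An invertible corner gives W M rank r, so M has rank r exactly when M = T W M for some T.
    Multiplying by W^* gives M W^* = T A with A the corner, which determines T. *)
Lemma rank_schur_red M : corner M \in unitmx -> \rank M = r <-> schur_red M = 0.
Proof.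
move=> uA; have dA : \det (corner M) != 0 by rewrite -unitfE -unitmxE.
have rWM : \rank (W *m M) = r.
  apply/eqP; rewrite eqn_leq rank_leq_row /= -{1}(mxrank_unit uA).
  exact: mxrankM_maxl.
split=> [rM|/eqP].
  have /submxP [T MT] : (M <= W *m M)%MS.
    by rewrite -(geq_leqif (mxrank_leqif_sup (submxMl W M))) rM rWM.
  apply/eqP; rewrite subr_eq0; apply/eqP.
  have -> : M *m adjmx W = T *m corner M by rewrite /corner {1}MT !mulmxA.
  by rewrite -(mulmxA T) mul_mx_adj mul_mx_scalar -scalemxAl -MT.
rewrite subr_eq0 => /eqP eM.
apply/eqP; rewrite eqn_leq; apply/andP; split; last first.
  by rewrite -{1}rWM mxrankM_maxr.
rewrite -(mxrank_scale_nz M dA) eM.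
by apply: leq_trans (mxrankM_maxr _ _) _; rewrite rWM.
Qed.

(** [W] on the left and W^* on the right annihilate the Schur complement; by the resolution of the
    identity in the frame only its K-block remains. *)
Lemma schur_red_compress M : K *m schur_red M *m adjmx K = 0 -> schur_red M = 0.
Proof.
have [_ _ _ [XW _ _]] := fr; move=> KMK.
have WX : adjmx W *m X + adjmx K *m K = 1%:M.
  by apply: (can_inj (@adjmxK R _ _)); rewrite adjmxD !adjmxM !adjmxK adjmx1.
have l0 : W *m schur_red M = 0.
  rewrite /schur_red mulmxBr -scalemxAr !mulmxA -/(corner M) mul_mx_adj.
  by rewrite mul_scalar_mx -scalemxAl subrr.
have r0 : schur_red M *m adjmx W = 0.
  rewrite /schur_red mulmxBl -scalemxAl -!mulmxA (mulmxA W) -/(corner M) mul_adj_mx.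
  by rewrite mul_mx_scalar -!scalemxAr subrr.
rewrite -[LHS]mul1mx -XW mulmxDl -mulmxA l0 mulmx0 add0r.
rewrite -[LHS]mulmx1 -WX mulmxDr !mulmxA -(mulmxA (_ *m K)) r0 mulmx0 mul0mx add0r.
by rewrite -(mulmxA (adjmx K)) -(mulmxA (adjmx K)) KMK mulmx0 mul0mx.
Qed.

Lemma corner_adj M : adjmx (corner M) = corner (adjmx M).
Proof. by rewrite /corner !adjmxM adjmxK mulmxA. Qed.

Lemma schur_red_adj M : adjmx (schur_red M) = schur_red (adjmx M).
Proof.
rewrite /schur_red adjmxB adjmxZ -det_adjmx corner_adj; congr (_ - _).
by rewrite !adjmxM adjmxK adjmx_adj corner_adj !mulmxA.
Qed.

(** With A the corner, M = (W M)^* A^-1 (W M), and A^-1 is congruent to A. *)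
Lemma schur_red_psd M : M = adjmx M -> corner M \in unitmx -> psdmx (corner M) ->
  schur_red M = 0 -> psdmx M.
Proof.
move=> hM uA [hA pA] /eqP; rewrite subr_eq0 => /eqP eM.
have dA : \det (corner M) != 0 by rewrite -unitfE -unitmxE.
have eI : adjmx (invmx (corner M)) *m corner M *m invmx (corner M) = invmx (corner M).
  by rewrite adjmx_inv -hA mulVmx // mul1mx.
have -> : M = adjmx (W *m M) *m invmx (corner M) *m (W *m M).
  rewrite /invmx uA -scalemxAr -scalemxAl adjmxM -hM -eM scalerA mulVf // scale1r //.
by rewrite -eI; apply: psd_conj; apply: psd_conj.
Qed.

Lemma corner_frame : corner p = 1%:M.
Proof.
have [-> WX _ _] := fr; rewrite /corner mulmxA WX mul1mx.
by rewrite -(adjmxK X) -adjmxM WX adjmx1.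
Qed.

Lemma frame_kernel : K *m p = 0 /\ p *m adjmx K = 0.
Proof.
have [-> _ KX _] := fr; split; first by rewrite mulmxA KX mul0mx.
by rewrite -mulmxA -{2}(adjmxK X) -adjmxM KX adjmx0 mulmx0.
Qed.

Lemma row_free_corner M : corner M \in unitmx -> row_free (W *m M).
Proof.
move=> uA; rewrite -row_leq_rank -{1}(mxrank_unit uA).
exact: mxrankM_maxl.
Qed.

Lemma eqmx_corner M : \rank M = r -> corner M \in unitmx -> (W *m M :=: M)%MS.
Proof.
move=> rM uA; apply/eqmxP; rewrite submxMl /=.
rewrite -(geq_leqif (mxrank_leqif_sup (submxMl W M))) rM.
by have /eqP -> := row_free_corner uA.
Qed.

End SchurReduction.

(** * Real coordinates *)

Section HermitianCoordinates.
Variable R : realType.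
Local Notation C := (R[i]).

(* A real-linear bijection from the Hermitian matrices onto all real matrices: the
   real and imaginary parts are the symmetric and antisymmetric parts of the image. *)
Definition hermc m n (Z : 'M[C]_(m, n)) : 'M[R]_(m, n) :=
  map_mx (@complex.Re R) Z + map_mx (@complex.Im R) Z.

Lemma hermcE m n (Z : 'M[C]_(m, n)) i j :
  hermc Z i j = complex.Re (Z i j) + complex.Im (Z i j).
Proof. by rewrite !mxE. Qed.

Lemma hermc_eq0 n (Z : 'M[C]_n) : Z = adjmx Z -> hermc Z = 0 -> Z = 0.
Proof.
move=> hZ /matrixP h; apply/matrixP => i j.
have := h i j; have := h j i; rewrite !hermcE !mxE.
have -> : Z j i = conjc (Z i j) by rewrite {1}hZ adjmxE.
case: (Z i j) => a b /= e1 e2; apply/eqP; rewrite eq_complex /=.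
by apply/andP; split; apply/eqP; lra.
Qed.

Lemma hermc_onto n (Y : 'M[R]_n) : exists Z : 'M[C]_n, Z = adjmx Z /\ hermc Z = Y.
Proof.
exists (\matrix_(i, j) Complex ((Y i j + Y j i) / 2) ((Y i j - Y j i) / 2)).
split; apply/matrixP => i j; last by rewrite hermcE !mxE /=; field.
rewrite !mxE; apply/eqP; rewrite eq_complex /= addrC eqxx /=.
by apply/eqP; field.
Qed.

Lemma hermc_row_mx m n1 n2 (A : 'M[C]_(m, n1)) (B : 'M[C]_(m, n2)) :
  hermc (row_mx A B) = row_mx (hermc A) (hermc B).
Proof. by rewrite /hermc !map_row_mx add_row_mx. Qed.

Lemma hermc_mxvec m n (A : 'M[C]_(m, n)) : hermc (mxvec A) = mxvec (hermc A).
Proof. by rewrite /hermc !map_mxvec linearD. Qed.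

Lemma half_double m n (M : 'M[C]_(m, n)) : 2^-1 *: (M + M) = M.
Proof.
by rewrite -{1 2}[M]scale1r -scalerDl scalerA (_ : 2^-1 * (1 + 1) = 1) ?scale1r //; field.
Qed.

(** The local equations live on all matrices; inserting the Hermitian part keeps their values
    Hermitian, where [hermc] is injective. *)
Definition hpart n (M : 'M[C]_n) : 'M[C]_n := 2^-1 *: (M + adjmx M).

Lemma hpart_herm n (M : 'M[C]_n) : M = adjmx M -> hpart M = M.
Proof.
by move=> hM; rewrite /hpart -hM half_double.
Qed.

Definition unrealify n (x : 'rV[R]_(n * n + n * n)) : 'M[C]_n :=
  \matrix_(i, j) Complex (x 0 (lshift _ (mxvec_index i j)))
                         (x 0 (rshift _ (mxvec_index i j))).

Lemma realifyK n : cancel (@realify R n) (@unrealify n).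
Proof.
move=> M; apply/matrixP => i j; rewrite mxE row_mxEl row_mxEr !mxvecE !mxE.
by case: (M i j).
Qed.

Lemma unrealifyK n : cancel (@unrealify n) (@realify R n).
Proof.
move=> x; apply/rowP => k; rewrite /realify.
by case: (split_ordP k) => j ->; case/mxvec_indexP: j => a b;
  rewrite ?row_mxEl ?row_mxEr mxvecE !mxE.
Qed.

Lemma mxcpoly_unrealify n : mxcpoly (@unrealify n).
Proof.
move=> i j; pose a := lshift (n * n) (mxvec_index i j).
pose b := rshift (n * n) (mxvec_index i j).
apply: (@cpoly_ext _ _ (fun x => real_complex R (x 0 a) + 'i%C * real_complex R (x 0 b))).
  by move=> x; rewrite mxE [RHS]complexE.
by apply: cpolyD; [exact: cpoly_coord|apply: cpolyZ; exact: cpoly_coord].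
Qed.

End HermitianCoordinates.

(** * Derivatives of matrix-valued functions *)

Section MatrixDerivative.
Variables (R : realType) (N : nat).
Local Notation C := (R[i]).
Implicit Types x v : 'rV[R]_N.

Definition mxcder m n (A : 'rV[R]_N -> 'M[C]_(m, n)) x v (B : 'M[C]_(m, n)) :=
  forall i j, cder (fun y => A y i j) x v (B i j).

Lemma mxcder_ext m n (A B : 'rV[R]_N -> 'M[C]_(m, n)) x v D :
  A =1 B -> mxcder A x v D -> mxcder B x v D.
Proof. by move=> /funext ->. Qed.

Lemma mxcder_cst m n (A : 'M[C]_(m, n)) x v : mxcder (fun=> A) x v 0.
Proof. by move=> i j; rewrite mxE; exact: cder_cst. Qed.

Lemma mxcderD m n (A B : 'rV[R]_N -> 'M[C]_(m, n)) x v A' B' :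
  mxcder A x v A' -> mxcder B x v B' -> mxcder (fun y => A y + B y) x v (A' + B').
Proof.
move=> hA hB i j; rewrite mxE; apply: cder_ext (cderD (hA i j) (hB i j)) => y.
by rewrite mxE.
Qed.

Lemma mxcderZ m n f (A : 'rV[R]_N -> 'M[C]_(m, n)) x v f' A' :
  cder f x v f' -> mxcder A x v A' ->
  mxcder (fun y => f y *: A y) x v (f x *: A' + f' *: A x).
Proof.
move=> hf hA i j; rewrite !mxE; apply: cder_ext (cderM hf (hA i j)) => y.
by rewrite mxE.
Qed.

Lemma mxcderZc m n c (A : 'rV[R]_N -> 'M[C]_(m, n)) x v A' :
  mxcder A x v A' -> mxcder (fun y => c *: A y) x v (c *: A').
Proof.
by move=> hA; have := mxcderZ (cder_cst c x v) hA; rewrite scale0r addr0.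
Qed.

Lemma mxcderN m n (A : 'rV[R]_N -> 'M[C]_(m, n)) x v D :
  mxcder A x v D -> mxcder (fun y => - A y) x v (- D).
Proof.
move=> /(mxcderZc (-1)); rewrite scaleN1r; apply: mxcder_ext => y.
by rewrite scaleN1r.
Qed.

Lemma cder_sum I (s : seq I) (F : I -> 'rV[R]_N -> C) x v F' :
  (forall i, cder (F i) x v (F' i)) ->
  cder (fun y => \sum_(i <- s) F i y) x v (\sum_(i <- s) F' i).
Proof.
move=> h; elim: s => [|i s IH].
  by rewrite big_nil; apply: cder_ext (cder_cst 0 x v) => y; rewrite big_nil.
by rewrite big_cons; apply: cder_ext (cderD (h i) IH) => y; rewrite big_cons.
Qed.

Lemma mxcderM m n p (A : 'rV[R]_N -> 'M[C]_(m, n)) (B : 'rV[R]_N -> 'M[C]_(n, p))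
    x v A' B' :
  mxcder A x v A' -> mxcder B x v B' ->
  mxcder (fun y => A y *m B y) x v (A x *m B' + A' *m B x).
Proof.
move=> hA hB i j; rewrite !mxE -big_split /=.
have h : cder (fun y => \sum_k A y i k * B y k j) x v
    (\sum_k (A x i k * B' k j + A' i k * B x k j)).
  by apply: cder_sum => k; exact: cderM.
by apply: cder_ext h => y; rewrite mxE.
Qed.

Lemma mxcder_adj m n (A : 'rV[R]_N -> 'M[C]_(m, n)) x v A' :
  mxcder A x v A' -> mxcder (fun y => adjmx (A y)) x v (adjmx A').
Proof.
move=> hA i j; have [hr hi] := hA j i.
have cE y k l : adjmx y k l = conjc (y l k) :> C by rewrite adjmxE.
split.
  rewrite cE (_ : (fun y => _) = (fun y => complex.Re (A y j i))).
    by case: (A' j i) hr.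
  by apply/funext => y; rewrite cE; case: (A y j i).
rewrite cE (_ : (fun y => _) = (fun y => - complex.Im (A y j i))).
  have -> : complex.Im (conjc (A' j i)) = - complex.Im (A' j i) by case: (A' j i).
  exact: is_deriveN hi.
by apply/funext => y; rewrite cE; case: (A y j i).
Qed.

Lemma cder_exists f x v : cpoly f -> exists b, cder f x v b.
Proof. by case/cpoly_deriv => g [_ /(_ x v) h]; eexists; exact: h. Qed.

(** Serves for factors whose derivative gets multiplied by zero, so that its value is irrelevant. *)
Lemma mxcder_exists m n (A : 'rV[R]_N -> 'M[C]_(m, n)) x v :
  mxcpoly A -> exists B, mxcder A x v B.
Proof.
move=> pA.
have /choice [b hb] : forall ij : 'I_m * 'I_n, exists b, cder (fun y => A y ij.1 ij.2) x v b.
  by move=> ij; exact: cder_exists.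
by exists (\matrix_(i, j) b (i, j)) => i j; rewrite mxE; exact: (hb (i, j)).
Qed.

Lemma mxcder_ptrace s t (A : 'rV[R]_N -> 'M[C]_(s * t)) x v A' :
  mxcder A x v A' -> mxcder (fun y => ptraceB (A y)) x v (ptraceB A').
Proof.
move=> hA i j; rewrite mxE.
have := cder_sum (index_enum 'I_t) (fun k : 'I_t => hA (mxtens_index (i, k)) (mxtens_index (j, k))).
by apply: cder_ext => y; rewrite mxE.
Qed.

Lemma mxcder_row_mx m n1 n2 (A : 'rV[R]_N -> 'M[C]_(m, n1)) (B : 'rV[R]_N -> 'M[C]_(m, n2))
    x v A' B' : mxcder A x v A' -> mxcder B x v B' ->
  mxcder (fun y => row_mx (A y) (B y)) x v (row_mx A' B').
Proof.
move=> hA hB i j; case: (split_ordP j) => k ->.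
  by rewrite row_mxEl; apply: cder_ext (hA i k) => y; rewrite row_mxEl.
by rewrite row_mxEr; apply: cder_ext (hB i k) => y; rewrite row_mxEr.
Qed.

Lemma mxcpoly_row_mx m n1 n2 (A : 'rV[R]_N -> 'M[C]_(m, n1)) (B : 'rV[R]_N -> 'M[C]_(m, n2)) :
  mxcpoly A -> mxcpoly B -> mxcpoly (fun y => row_mx (A y) (B y)).
Proof.
move=> hA hB i j; case: (split_ordP j) => k ->.
  by apply: cpoly_ext (hA i k) => y; rewrite row_mxEl.
by apply: cpoly_ext (hB i k) => y; rewrite row_mxEr.
Qed.

Lemma mxcder_mxvec m n (A : 'rV[R]_N -> 'M[C]_(m, n)) x v A' :
  mxcder A x v A' -> mxcder (fun y => mxvec (A y)) x v (mxvec A').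
Proof.
move=> hA i j; rewrite ord1; case/mxvec_indexP: j => a b; rewrite mxvecE.
by apply: cder_ext (hA a b) => y; rewrite mxvecE.
Qed.

Lemma mxcpoly_mxvec m n (A : 'rV[R]_N -> 'M[C]_(m, n)) :
  mxcpoly A -> mxcpoly (fun y => mxvec (A y)).
Proof.
move=> hA i j; rewrite ord1; case/mxvec_indexP: j => a b.
by apply: cpoly_ext (hA a b) => y; rewrite mxvecE.
Qed.

Lemma rpoly_hermc k (F : 'rV[R]_N -> 'rV[C]_k) :
  mxcpoly F -> rpoly (fun x => hermc (F x)).
Proof.
(* The real part of (1 - i) z is Re z + Im z. *)
move=> pF j; exists (fun x => (1 - 'i%C) * F x 0 j); split; first exact: cpolyZ.
by move=> x; rewrite hermcE cReM /=; ring.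
Qed.

Lemma derive_hermc k (F : 'rV[R]_N -> 'rV[C]_k) x v B : mxcpoly F -> mxcder F x v B ->
  'D_v (fun y => hermc (F y)) x = hermc B.
Proof.
move=> pF dF; have [G [_ dG]] := rpoly_derive (rpoly_hermc pF).
rewrite derive_mx; last by have [] := dG x v.
apply/rowP => j; rewrite mxE hermcE; have [dr di] := dF 0 j.
rewrite (_ : (fun y => _) = (fun y => complex.Re (F y 0 j) + complex.Im (F y 0 j))).
  exact: (@derive_val _ _ _ _ _ _ _ (is_deriveD dr di)).
by apply/funext => y; rewrite hermcE.
Qed.

End MatrixDerivative.

Lemma mxcder_unrealify (R : realType) n x v : mxcder (@unrealify R n) x v (unrealify v).
Proof.
move=> i j; pose a := lshift (n * n) (mxvec_index i j).
pose b := rshift (n * n) (mxvec_index i j).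
have h := cderD (cder_coord a x v) (cderM (cder_cst 'i%C x v) (cder_coord b x v)).
rewrite mul0r addr0 in h; rewrite [unrealify v i j]mxE [X in cder _ _ _ X]complexE.
by apply: cder_ext h => y; rewrite mxE [RHS]complexE.
Qed.

(** * Local equations of the Choi states of rank r *)

Section Chart.
Variables (R : realType) (s t r m : nat).
Local Notation C := (R[i]).
Local Notation n := (s * t)%N.
Variables (p : 'M[C]_n) (X W : 'M[C]_(r, n)) (K : 'M[C]_(m, n)).
Hypothesis fr : psd_frame p X W K.
Hypothesis cp : Choi R s t p.
Local Notation V := 'rV[R]_(n * n + n * n).

(** The blocks express Hermiticity, rank r and the partial trace. Each is a Hermitian matrix, so
    together they are n^2 + m^2 + s^2 real equations; for m = n - r this leaves dimension 2 n r -
    r^2 - s^2. *)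
Definition chartC (x : V) : 'rV[C]_(n * n + (m * m + s * s)) :=
  row_mx (mxvec ('i *: (unrealify x - adjmx (unrealify x))))
  (row_mx (mxvec (K *m schur_red W (hpart (unrealify x)) *m adjmx K))
          (mxvec (ptraceB (hpart (unrealify x)) - (s%:R)^-1%:M))).

Definition chart (x : V) := hermc (chartC x).

(** The first block yields Hermiticity, after which the Hermitian part is the matrix itself and the
    other blocks give its rank and partial trace. Positivity comes from the corner, whose own
    positivity is assumed conditionally on Hermiticity. *)
Lemma chart_eq0 x : corner W (unrealify x) \in unitmx ->
  (unrealify x = adjmx (unrealify x) -> psdmx (corner W (unrealify x))) ->
  chart x = 0 <-> ChoiRank R s t r (unrealify x).
Proof.
set M := unrealify x => uA pA.
have -> : chart x = row_mx (mxvec (hermc ('i *: (M - adjmx M))))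
  (row_mx (mxvec (hermc (K *m schur_red W (hpart M) *m adjmx K)))
          (mxvec (hermc (ptraceB (hpart M) - (s%:R)^-1%:M)))).
  by rewrite /chart /chartC -/M !hermc_row_mx !hermc_mxvec.
have hc0 k l : hermc (0 : 'M[C]_(k, l)) = 0.
  by apply/matrixP => i j; rewrite hermcE !mxE /= addr0.
split; last first.
  move=> [[[hM pM] trM] rM].
  rewrite -hM subrr scaler0 hpart_herm // trM subrr (_ : schur_red W M = 0).
    by rewrite mulmx0 mul0mx !hc0 !linear0 !row_mx0.
  by apply/rank_schur_red.
have z0 : 0 = row_mx 0 (row_mx 0 0) :> 'rV[R]_(n * n + (m * m + s * s)) by rewrite !row_mx0.
rewrite {1}z0 => /eq_row_mx [/eqP e1 /eq_row_mx [/eqP e2 /eqP e3]].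
rewrite mxvec_eq0 in e1; rewrite mxvec_eq0 in e2; rewrite mxvec_eq0 in e3.
have hM : M = adjmx M.
  have /eqP : 'i *: (M - adjmx M) = 0.
    apply: hermc_eq0 (eqP e1).
    by rewrite adjmxZ adjmxB adjmxK conjCi scaleNr -scalerN opprB.
  by rewrite scaler_eq0 (negPf (neq0Ci _)) subr_eq0 => /eqP.
rewrite hpart_herm // in e2 e3.
have red0 : schur_red W M = 0.
  apply: (schur_red_compress fr); apply: hermc_eq0 (eqP e2).
  by rewrite !adjmxM adjmxK schur_red_adj -hM mulmxA.
have tr0 : ptraceB M - (s%:R)^-1%:M = 0.
  apply: hermc_eq0 (eqP e3).
  by rewrite adjmxB -ptraceB_adj -hM adjmx_scalar fmorphV rmorph_nat.
split; last by apply/(rank_schur_red uA).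
split; first by apply: (schur_red_psd hM uA (pA hM)).
by apply/eqP; rewrite -subr_eq0 tr0.
Qed.

Lemma mxcpoly_hpart : mxcpoly (fun x : V => hpart (unrealify x)).
Proof.
apply: mxcpolyZ; first exact: cpoly_cst.
apply: mxcpolyD; last apply: mxcpoly_adjmx; exact: mxcpoly_unrealify.
Qed.

Lemma mxcpoly_corner (A : V -> 'M[C]_n) : mxcpoly A -> mxcpoly (fun x => corner W (A x)).
Proof.
move=> hA; apply: mxcpolyM; last exact: mxcpoly_cst.
by apply: mxcpolyM => //; exact: mxcpoly_cst.
Qed.

Lemma mxcpoly_schur_red (A : V -> 'M[C]_n) :
  mxcpoly A -> mxcpoly (fun x => schur_red W (A x)).
Proof.
move=> hA; have hc := mxcpoly_corner hA.
apply: mxcpolyD; first by apply: mxcpolyZ => //; exact: cpoly_det.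
apply: mxcpolyN; apply: mxcpolyM; last by apply: mxcpolyM => //; exact: mxcpoly_cst.
apply: mxcpolyM; last exact: mxcpoly_adj.
by apply: mxcpolyM => //; exact: mxcpoly_cst.
Qed.

Lemma mxcpoly_chart : mxcpoly chartC.
Proof.
have hM := @mxcpoly_unrealify R n.
apply: mxcpoly_row_mx.
  apply: mxcpoly_mxvec; apply: mxcpolyZ; first exact: cpoly_cst.
  by apply: mxcpolyD => //; apply: mxcpolyN; exact: mxcpoly_adjmx.
apply: mxcpoly_row_mx; apply: mxcpoly_mxvec.
  apply: mxcpolyM; last exact: mxcpoly_cst.
  apply: mxcpolyM; first exact: mxcpoly_cst.
  exact/mxcpoly_schur_red/mxcpoly_hpart.
apply: mxcpolyD; last exact: mxcpoly_cst.
exact/mxcpoly_ptrace/mxcpoly_hpart.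
Qed.

Lemma rpoly_chart : rpoly chart.
Proof. exact/rpoly_hermc/mxcpoly_chart. Qed.

(** Displays the correction term as a product with two off-diagonal blocks, both zero at [p], so
    that it vanishes there to second order. *)
Lemma schur_red_blocks (M : 'M[C]_n) : K *m schur_red W M *m adjmx K =
  \det (corner W M) *: (K *m M *m adjmx K) -
  K *m M *m adjmx W *m \adj (corner W M) *m (W *m M *m adjmx K).
Proof.
by rewrite /schur_red mulmxBr mulmxBl -scalemxAr -scalemxAl !mulmxA.
Qed.

Lemma mxcder_chart v : mxcder chartC (realify p) v
  (row_mx (mxvec ('i *: (unrealify v - adjmx (unrealify v))))
  (row_mx (mxvec (K *m hpart (unrealify v) *m adjmx K))
          (mxvec (ptraceB (hpart (unrealify v)))))).
Proof.
have dM := @mxcder_unrealify R n (realify p) v.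
have dH : mxcder (fun x => hpart (unrealify x)) (realify p) v (hpart (unrealify v)).
  by apply: mxcderZc; apply: mxcderD => //; exact: mxcder_adj.
have Hp : hpart (unrealify (realify p)) = p by rewrite realifyK hpart_herm //; case: cp => -[].
have dL k (A : 'M[C]_(k, n)) : mxcder (fun x => A *m hpart (unrealify x)) (realify p) v
    (A *m hpart (unrealify v)).
  by have := mxcderM (mxcder_cst A (realify p) v) dH; rewrite mul0mx addr0.
have dLR k l (A : 'M[C]_(k, n)) (B : 'M[C]_(n, l)) :
    mxcder (fun x => A *m hpart (unrealify x) *m B) (realify p) v
    (A *m hpart (unrealify v) *m B).
  by have := mxcderM (dL _ A) (mxcder_cst B (realify p) v); rewrite mulmx0 add0r.
apply: mxcder_row_mx.
  apply/mxcder_mxvec/mxcderZc/mxcderD => //; apply: mxcderN; exact: mxcder_adj.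
apply: mxcder_row_mx; apply: mxcder_mxvec; last first.
  rewrite -[ptraceB (hpart (unrealify v))]addr0.
  by apply: mxcderD; [exact: mxcder_ptrace|exact: mxcder_cst].
have pc := mxcpoly_corner mxcpoly_hpart.
(* The derivatives of determinant and adjugate stay unspecified: K p = 0 and p K^* = 0 cancel every
   term containing them. *)
have [d dd] := cder_exists (realify p) v (cpoly_det pc).
have [D dD] := mxcder_exists (realify p) v (mxcpoly_adj pc).
apply: (@mxcder_ext _ _ _ _ (fun x => \det (corner W (hpart (unrealify x))) *:
    (K *m hpart (unrealify x) *m adjmx K) -
  K *m hpart (unrealify x) *m adjmx W *m \adj (corner W (hpart (unrealify x))) *m
    (W *m hpart (unrealify x) *m adjmx K))).
  by move=> x; rewrite schur_red_blocks.
have := mxcderD (mxcderZ dd (dLR _ _ K (adjmx K)))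
  (mxcderN (mxcderM (mxcderM (dLR _ _ K (adjmx W)) dD) (dLR _ _ W (adjmx K)))).
rewrite Hp (corner_frame fr) det1 scale1r; have [-> pK] := frame_kernel fr.
by rewrite -(mulmxA W p) pK !(mul0mx, mulmx0, scaler0, addr0, oppr0, add0r).
Qed.

Lemma chart_onto (w : 'rV[R]_(n * n + (m * m + s * s))) :
  exists v, 'D_v chart (realify p) = w.
Proof.
have [[hp _] trp] := cp.
have [Kp pK] := frame_kernel fr.
have [_ _ _ [_ KK _]] := fr.
have [Z1 [h1 e1]] := hermc_onto (vec_mx (lsubmx w)).
have [Z2 [h2 e2]] := hermc_onto (vec_mx (lsubmx (rsubmx w))).
have [Z3 [h3 e3]] := hermc_onto (vec_mx (rsubmx (rsubmx w))).
have cnat k : Num.conj (k%:R : C) = k%:R by rewrite rmorph_nat.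
(* Since p (G (x) 1) + (G (x) 1) p has zero K-block and partial trace 2 G / s, this [G] corrects the
   trace without changing the block [Z2]. *)
pose G := (s%:R / 2) *: (Z3 - ptraceB (adjmx K *m Z2 *m K)).
have hG : adjmx G = G.
  rewrite /G adjmxZ adjmxB -h3 -ptraceB_adj !adjmxM adjmxK -h2 mulmxA.
  by rewrite rmorphM fmorphV /= !cnat.
pose V2 := adjmx K *m Z2 *m K + (p *m (G *t 1%:M) + (G *t 1%:M) *m p).
have hV2 : V2 = adjmx V2.
  rewrite /V2 !adjmxD !adjmxM adjmxK adjmx_tens1 hG -h2 -hp mulmxA.
  by congr (_ + _); rewrite addrC.
have KV2 : K *m V2 *m adjmx K = Z2.
  rewrite /V2 !mulmxDr !mulmxDl !mulmxA Kp KK mul1mx !mul0mx add0r.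
  by rewrite -!mulmxA KK pK !mulmx0 mulmx1 addr0.
have trV2 : ptraceB V2 = Z3.
  rewrite /V2 !linearD /= ptraceB_tensr ptraceB_tensl trp.
  rewrite mul_scalar_mx mul_mx_scalar -scalerDl /G scalerA.
  (* For s = 0 the factor s cannot be cancelled, but the matrices have no entries. *)
  have [s0|s0] := posnP s.
    by apply/matrixP => -[i hi]; exfalso; move: hi; rewrite s0.
  have -> : (s%:R^-1 + s%:R^-1) * (s%:R / 2) = 1 :> C.
    by field; rewrite pnatr_eq0 -lt0n.
  by rewrite scale1r addrC subrK.
(* Anti-Hermitian, hence invisible to [hpart]; subtracting it contributes - 2 i V1 = Z1 to the first
   block. *)
pose V1 := ('i / 2) *: Z1.
have hV1 : adjmx V1 = - V1.
  by rewrite /V1 adjmxZ -h1 rmorphM /= conjCi fmorphV /= cnat mulNr scaleNr.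
exists (realify (V2 - V1)).
rewrite (derive_hermc mxcpoly_chart (mxcder_chart _)) realifyK.
have -> : hpart (V2 - V1) = V2.
  rewrite /hpart adjmxB -hV2 hV1 opprK addrACA addNr addr0.
  by rewrite half_double.
have -> : 'i *: (V2 - V1 - adjmx (V2 - V1)) = Z1.
  rewrite adjmxB -hV2 hV1 opprK opprD addrACA subrr add0r /V1 -opprD -scalerDl.
  rewrite scalerN scalerA -scaleNr (_ : - _ = 1) ?scale1r //.
  have -> : 'i / 2 + 'i / 2 = 'i :> C by field.
  by rewrite -expr2 sqrCi opprK.
rewrite KV2 trV2 !hermc_row_mx !hermc_mxvec e1 e2 e3 !vec_mxK.
by rewrite !hsubmxK.
Qed.

End Chart.

(** * Extreme Choi states *)

Section ExtremeChoiStates.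
Variable R : realType.
Local Notation C := (R[i]).

(** With [B] fixed, the determinant condition is open in [A] and certifies full rank. *)
Lemma det_neq0_row_free (F : fieldType) k l (A : 'M[F]_(k, l)) (B : 'M[F]_(l, k)) :
  \det (A *m B) != 0 -> row_free A.
Proof.
move=> d; apply/row_freeP; exists (B *m invmx (A *m B)).
by rewrite mulmxA mulmxV // unitmxE unitfE.
Qed.

Lemma det_neq0_rank (F : fieldType) k l (A : 'M[F]_(k, l)) (B : 'M[F]_(l, k)) :
  \det (A *m B) != 0 -> \rank B = k.
Proof.
move=> d; apply/eqP; rewrite -[_ == _]/(row_full B).
apply/row_fullP; exists (invmx (A *m B) *m A).
by rewrite -mulmxA mulVmx // unitmxE unitfE.
Qed.

(** The squared Hilbert-Schmidt norm is polynomial and dominates every squared entry, so one open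
    condition gives the entrywise bound. *)
Lemma corner_psd_near r n (W : 'M[C]_(r, n)) M :
  complex.Re (\sum_i \sum_j (corner W M - 1%:M) i j * Num.conj ((corner W M - 1%:M) i j))
    < (r.+1%:R^-1) ^+ 2 ->
  M = adjmx M -> psdmx (corner W M).
Proof.
set E := corner W M - 1%:M => small hM.
apply: psd_near1 => [|i j]; first by rewrite corner_adj -hM.
rewrite -/E -(@ler_pXn2r _ 2) ?nnegrE //; last by rewrite invr_ge0.
apply: (@le_trans _ _ (\sum_i \sum_j E i j * Num.conj (E i j))).
  have E0 i' j' : 0 <= E i' j' * Num.conj (E i' j') by rewrite -normCK exprn_ge0.
  rewrite (bigD1 i) //= (bigD1 j) //= normCK -addrA lerDl addr_ge0 // sumr_ge0 //.
  by move=> k _; rewrite sumr_ge0.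
have real_sum : \sum_i \sum_j E i j * Num.conj (E i j) \is Num.real.
  rewrite rpred_sum // => i' _; rewrite rpred_sum // => j' _.
  by rewrite -normCK rpredX // normr_real.
rewrite -(RRe_real real_sum) (_ : r.+1%:R^-1 = real_complex R (r.+1%:R^-1)).
  by rewrite -rmorphXn lecR ltW.
by rewrite fmorphV rmorph_nat.
Qed.

Lemma ChoiRank_chart s t r p : ChoiRank R s t r p ->
  exists U, [/\ open U, U (realify p) &
    exists F : 'rV[R]_((s * t) * (s * t) + (s * t) * (s * t)) ->
      'rV[R]_((s * t) * (s * t) + ((s * t - r) * (s * t - r) + s * s)),
    [/\ rpoly F,
        (forall x, U x -> \rank (Defs.jacobian F x) =
           ((s * t) * (s * t) + ((s * t - r) * (s * t - r) + s * s))%N) &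
        realify @` ChoiRank R s t r `&` U = U `&` F @^-1` [set 0]]].
Proof.
move=> [cp rp]; have [X [W [K fr]]] := psd_frame_exists cp.1.
rewrite rp in X W K fr.
pose F := chart W K.
have rF : rpoly F := rpoly_chart W K.
have [JE pJ] := rpoly_jacobian rF.
(* The derivative at [p] is onto; a left inverse [G] of the Jacobian there, kept fixed, certifies
   full rank nearby. *)
have /row_fullP [G GJ] : row_full (Defs.jacobian F (realify p)).
  rewrite -sub1mx; apply/row_subP => i.
  have [v hv] := chart_onto fr cp (row i 1%:M).
  by rewrite -hv -JE submxMl.
pose M x := @unrealify R (s * t) x.
have pM : mxcpoly M := @mxcpoly_unrealify R (s * t).
have pE : mxcpoly (fun x => corner W (M x) - 1%:M).
  apply: mxcpolyD; last exact: mxcpoly_cst.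
  exact: mxcpoly_corner.
(* [U1] keeps the corner positive, [U2] keeps it invertible, [U3] keeps the equations
   independent. *)
pose U1 := [set x | complex.Re (\sum_i \sum_j (corner W (M x) - 1%:M) i j *
   Num.conj ((corner W (M x) - 1%:M) i j)) < (r.+1%:R^-1) ^+ 2].
pose U2 := [set x | \det (corner W (M x)) != 0].
pose U3 := [set x | \det (map_mx (real_complex R) G *m
   map_mx (real_complex R) (Defs.jacobian F x)) != 0].
have U3E x : U3 x = (\det (G *m Defs.jacobian F x) != 0).
  by rewrite /U3 /= -map_mxM det_map_mx fmorph_eq0.
have c1 : corner W p = 1%:M := corner_frame fr.
exists (U1 `&` U2 `&` U3); split.
- apply: openI; first apply: openI.
  + apply: open_cpoly_lt; apply: cpoly_sum => i; apply: cpoly_sum => j.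
    by apply: cpolyM; [exact: pE|apply: cpoly_conj; exact: pE].
  + by apply: open_cpoly_neq0; apply: cpoly_det; exact: mxcpoly_corner.
  + apply: open_cpoly_neq0; apply: cpoly_det; apply: mxcpolyM => //.
    exact: mxcpoly_cst.
- split; last by rewrite U3E GJ det1 oner_neq0.
  rewrite /U1 /U2 /M; split => /=.
  + rewrite realifyK c1 subrr big1 /=; last first.
      by move=> i _; rewrite big1 // => j _; rewrite mxE mul0r.
    by rewrite exprn_gt0 // invr_gt0 ltr0Sn.
  + by rewrite realifyK c1 det1 oner_neq0.
exists F; split=> //.
- by move=> x [_]; rewrite U3E => /det_neq0_rank.
have zero x : U1 x -> U2 x -> F x = 0 <-> ChoiRank R s t r (M x).
  move=> u1 u2; apply: (chart_eq0 fr); first by rewrite unitmxE unitfE.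
  exact: corner_psd_near u1.
apply/seteqP; split=> x.
  move=> [[q cq <-] u]; split=> //=; have [[u1 u2] _] := u.
  by apply/zero => //; rewrite /M realifyK.
move=> [u /= Fx]; split=> //; have [[u1 u2] _] := u.
by exists (M x); [apply/zero|rewrite /M unrealifyK].
Qed.

(** [W] need not come from a frame of [p]: one [W] serves all states near a given one, and the rows
    of W p then span the support of [p]. *)
Lemma ChoiExt_ptrace_lift s t r p (W : 'M[C]_(r, s * t)) : ChoiRank R s t r p ->
  corner W p \in unitmx ->
  ChoiExt R s t r p <-> row_free (lin_mx (ptrace_lift (W *m p))).
Proof.
move=> crp uA; have [cp rp] := crp.
have yf := row_free_corner uA; have ye := eqmx_corner rp uA.
split.
  case=> _ /(extreme_faithful cp) /(ptrace_faithfulP yf ye) h.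
  exact/row_free_ptrace_lift.
move=> /row_free_ptrace_lift h; split=> //.
by apply/(extreme_faithful cp)/(ptrace_faithfulP yf ye).
Qed.

Lemma ChoiExt_open s t r : exists U : set 'rV[R]_((s * t) * (s * t) + (s * t) * (s * t)),
  open U /\ realify @` ChoiExt R s t r = realify @` ChoiRank R s t r `&` U.
Proof.
pose good V := open V /\ forall q, ChoiRank R s t r q -> V (realify q) -> ChoiExt R s t r q.
exists (\bigcup_(V in good) V); split; first by apply: bigcup_open => V [].
apply/seteqP; split=> x; last first.
  by move=> [[q cq <-] [V [_ hV] Vx]]; exists q => //; exact: hV.
move=> [p ep <-]; have crp := ep.1; split; first by exists p.
have [X [W [K fr]]] := psd_frame_exists crp.1.1.
rewrite crp.2 in X W K fr.
have c1 := corner_frame fr.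
have uA : corner W p \in unitmx by rewrite c1 unitmx1.
have /row_freeP [B LB] := (ChoiExt_ptrace_lift crp uA).1 ep.
have pM := @mxcpoly_unrealify R (s * t).
(* [W] and the right inverse [B] are those of the base point, where both determinants equal 1. *)
exists ([set x | \det (corner W (unrealify x)) != 0] `&`
        [set x | \det (lin_mx (ptrace_lift (W *m unrealify x)) *m B) != 0]); last first.
  by split; rewrite /= realifyK ?c1 ?LB det1 oner_neq0.
split.
  apply: openI; apply: open_cpoly_neq0; apply: cpoly_det.
    exact: mxcpoly_corner.
  apply: mxcpolyM; last exact: mxcpoly_cst.
  by apply: mxcpoly_ptrace_lift; apply: mxcpolyM => //; exact: mxcpoly_cst.
move=> q cq [/=]; rewrite realifyK => dq /det_neq0_row_free fq.
by apply/(ChoiExt_ptrace_lift (W := W) cq) => //; rewrite unitmxE unitfE.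
Qed.

(** An injective linear map from r x r to s x s matrices forces r^2 <= s^2. *)
Lemma ChoiExt_rank_le s t r p : ChoiExt R s t r p -> (r <= s)%N.
Proof.
move=> ep; have crp := ep.1.
have [X [W [K fr]]] := psd_frame_exists crp.1.1.
rewrite crp.2 in X W K fr.
have uA : corner W p \in unitmx by rewrite (corner_frame fr) unitmx1.
have := (ChoiExt_ptrace_lift crp uA).1 ep; rewrite -row_leq_rank => h.
have := leq_trans h (rank_leq_col _).
by rewrite !mulnn leq_sqr.
Qed.

Lemma ChoiExt_nonempty s t : (0 < t)%N -> (0 < s)%N -> ChoiExt R s t s !=set0.
Proof.
move=> t0 s0; pose k0 := Ordinal t0.
(* Row i is e_i (x) e_0, so Y^* X Y = X (x) |0><0| has partial trace X; this gives both the
   normalisation and the injectivity. *)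
pose Y : 'M[C]_(s, s * t) := \matrix_(i, k) (mxtens_unindex k == (i, k0))%:R.
have YE i j k : Y i (mxtens_index (j, k)) = ((j == i) && (k == k0))%:R.
  by rewrite mxE mxtens_indexK.
have trY (X : 'M[C]_s) : ptraceB (adjmx Y *m X *m Y) = X.
  have XY i j k : (X *m Y) i (mxtens_index (j, k)) = X i j * (k == k0)%:R.
    rewrite mxE (bigD1 j) //= YE eqxx big1 ?addr0 // => l lj.
    by rewrite YE eq_sym (negPf lj) mulr0.
  have YXY i j k : (adjmx Y *m X *m Y) (mxtens_index (i, k)) (mxtens_index (j, k)) =
     X i j * (k == k0)%:R.
    rewrite -mulmxA mxE (bigD1 i) //= adjmxE YE eqxx XY big1 ?addr0.
      by rewrite rmorph_nat /=; case: (k == k0); rewrite ?mulr1 ?mul1r ?mulr0 ?mul0r.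
    by move=> l li; rewrite adjmxE YE eq_sym (negPf li) rmorph0 mul0r.
  apply/matrixP => i j; rewrite mxE (bigD1 k0) //= YXY eqxx mulr1 big1 ?addr0 //.
  by move=> k kk; rewrite YXY (negPf kk) mulr0.
have YY : Y *m adjmx Y = 1%:M.
  apply/matrixP => i j; rewrite mxE sum_mxtens !mxE (bigD1 i) //= [X in _ + X]big1.
    rewrite addr0 (bigD1 k0) //= [X in _ + X]big1 ?addr0.
      by rewrite adjmxE !YE !eqxx mul1r rmorph_nat andbT.
    by move=> k kk; rewrite YE (negPf kk) andbF mul0r.
  by move=> l li; rewrite big1 // => k _; rewrite YE (negPf li) mul0r.
have sn0 : (s%:R : C) != 0 by rewrite pnatr_eq0 -lt0n.
have fY : row_free Y by apply/row_freeP; exists (adjmx Y).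
pose p := s%:R^-1 *: (adjmx Y *m Y).
have eY : (Y :=: p)%MS.
  apply/eqmxP/andP; split; last by rewrite scalemx_sub // submxMl.
  apply/submxP; exists (s%:R *: Y).
  by rewrite /p -scalemxAl -scalemxAr scalerA divff // scale1r mulmxA YY mul1mx.
have cp : Choi R s t p.
  split; first by apply: psdZ; [rewrite invr_ge0|exact: psd_gram].
  by rewrite linearZ /= -[adjmx Y]mulmx1 trY scalemx1.
exists p; split.
  by split=> //; rewrite -eY; exact/eqP.
apply/(extreme_faithful cp)/(ptrace_faithfulP fY eY) => X.
by rewrite trY.
Qed.

(** All matrices involved are empty. *)
Lemma ChoiExt_nonempty0 t : ChoiExt R 0 t 0 !=set0.
Proof.
have c0 : Choi R 0 t 0.
  split; last by apply/matrixP => -[].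
  by split=> [|v]; rewrite ?adjmx0 // mulmx0 mul0mx mxE.
exists 0; split; first by split=> //; exact: mxrank0.
by split=> // y z _ _ l _ _; apply/matrixP => -[].
Qed.

End ExtremeChoiStates.

Theorem theorem4 (R : realType) (s t r : nat) :
  (s <= r * t)%N -> (r <= s * t)%N ->
  [/\ (* C^e_{s,t,r} is open in C_{s,t,r} (subspace topology of R^{2 s^2 t^2}) *)
      exists U : set 'rV[R]_((s * t) * (s * t) + (s * t) * (s * t)),
        open U /\ realify @` ChoiExt R s t r = realify @` ChoiRank R s t r `&` U,
      (* smooth embedded submanifold of R^{2 s^2 t^2} of dimension 2srt - r^2 - s^2 *)
      embedded_submanifold (2 * s * r * t - r ^ 2 - s ^ 2)%N
        (realify @` ChoiExt R s t r)
    & (* C^e_{s,t,s} is nonempty *)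
      ChoiExt R s t s !=set0].
Proof.
move=> s_rt r_st; have [Ue [oUe eUe]] := ChoiExt_open R s t r.
split; first by exists Ue.
  split.
    by nia.
  move=> _ [p ep <-]; have [U [oU Up [F [pF rkF zF]]]] := ChoiRank_chart ep.1.
  have rs := ChoiExt_rank_le ep.
  (* The truncated subtractions are exact: s <= r t times s plus r <= s t times r gives r^2 + s^2 <=
     2 s r t. *)
  have -> : ((s * t) * (s * t) + (s * t) * (s * t) - (2 * s * r * t - r ^ 2 - s ^ 2) =
     (s * t) * (s * t) + ((s * t - r) * (s * t - r) + s * s))%N.
    have : (r ^ 2 + s ^ 2 <= 2 * s * r * t)%N by nia.
    move: r_st; set n := (s * t)%N.
    have -> : (2 * s * r * t = 2 * n * r)%N by rewrite /n; nia.
    nia.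
  have Uep : Ue (realify p).
    have : (realify @` ChoiExt R s t r) (realify p) by exists p.
    by rewrite eUe => -[].
  (* Inside [Ue] the extreme states are all the states of rank r, so the same equations describe
     them. *)
  exists (U `&` Ue); split; [exact: openI|by []|].
  exists F; split.
  - exact: rpoly_smooth.
  - by move=> x [Ux _]; exact: rkF.
  - rewrite eUe; apply/seteqP; split=> x.
      move=> [[cx uex] [ux _]]; split=> //.
      have : (realify @` ChoiRank R s t r `&` U) x by [].
      by rewrite zF => -[].
    move=> [[ux uex] fx]; have : (U `&` F @^-1` [set 0]) x by [].
    by rewrite -zF => -[].
(* For positive s, the bound s <= r t excludes t = 0. *)
case: s {Ue oUe eUe} s_rt r_st => [|s] s_rt _; first exact: ChoiExt_nonempty0.
by apply: ChoiExt_nonempty => //; case: t s_rt => //; rewrite muln0.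
Qed.
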